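(* Let $G=(V,E)$ be a graph with $n$ vertices and $m$ edges, let $k$ be an integer, and suppose we are given a block graph deletion set $D$ of $G$ with $|D|=\mathrm{bd}(G)$. Then \textsc{Densest $k$-Subgraph} and \textsc{Sparsest $k$-Subgraph} on $(G,k)$ can be solved in time $O\big(2^{\mathrm{bd}(G)}((k^3+\mathrm{bd}(G))n+m)\big)$.
   Context: All graphs are finite, simple and undirected. \textsc{Densest $k$-Subgraph}: given a graph $G=(V,E)$ and an integer $k$, find $S\subseteq V$ with $|S|=k$ maximizing the number of edges of the induced subgraph $G[S]$; \textsc{Sparsest $k$-Subgraph}: the same but minimizing. A block of a graph is a maximal connected subgraph without a cut vertex (a maximal 2-connected component, or a bridge/isolated vertex). A block graph is a graph in which every block is a clique. A block graph deletion set of $G$ is a set $D\subseteq V$ such that $G[V\setminus D]$ is a block graph; the block deletion number $\mathrm{bd}(G)$ is the minimum size of such a set. *)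

(* Defs.v *)
From mathcomp Require Import all_boot.

Set Implicit Arguments.
Unset Strict Implicit.
Unset Printing Implicit Defensive.

(* A graph is a pair (V, E) over an ambient finite type, so that G, its
   induced subgraphs and its blocks all live in the same (finite) type.
   Membership in [graph T] alone does not make E a set of edges on V: that is
   [simple_graph]. *)
Definition graph (T : finType) := ({set T} * {set {set T}})%type.

Section Graphs.
Variable T : finType.
Implicit Types (G H K : graph T) (S D : {set T}) (x y : T).

Definition vertices G : {set T} := G.1.
Definition edges G : {set {set T}} := G.2.

Definition pairs_of S : {set {set T}} := [set A : {set T} | (A \subset S) && (#|A| == 2)].

Definition simple_graph G : bool := edges G \subset pairs_of (vertices G).

Definition adjacent G : rel T := fun x y => [set x; y] \in edges G.

Definition subgraph H G : bool :=
  [&& simple_graph H, vertices H \subset vertices G & edges H \subset edges G].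

Definition induced G S : graph T :=
  (vertices G :&: S, [set A in edges G | A \subset S]).

Definition delete G D : graph T := induced G (~: D).

Definition components G : nat := n_comp (adjacent G) (vertices G).

(* The graph without vertices has no component, hence is not connected. *)
Definition connected_graph G : bool := components G == 1.

Definition cut_vertex G x : bool :=
  (x \in vertices G) && (components G < components (delete G [set x])).

Definition nonseparable G : bool :=
  connected_graph G && [forall x, ~~ cut_vertex G x].

Definition block G H : bool :=
  [&& subgraph H G, nonseparable H &
      [forall K : graph T,
         [&& subgraph K G, nonseparable K & subgraph H K] ==> (K == H)]].

Definition complete_graph G : bool := edges G == pairs_of (vertices G).

Definition block_graph G : bool :=
  [forall H : graph T, block G H ==> complete_graph H].

Definition block_deletion_set G D : bool :=
  (D \subset vertices G) && block_graph (delete G D).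

(* The default [vertices G] of the arg min is a block graph deletion set: see
   [block_deletion_set_vertices]. *)
Definition bd G : nat :=
  #|[arg min_(D < vertices G | block_deletion_set G D) #|D|]|.

Definition induced_edges G S : nat := #|edges (induced G S)|.

Definition densest_subgraph G (k : nat) S : Prop :=
  [/\ S \subset vertices G, #|S| = k &
      forall S', S' \subset vertices G -> #|S'| = k ->
        induced_edges G S' <= induced_edges G S].

Definition sparsest_subgraph G (k : nat) S : Prop :=
  [/\ S \subset vertices G, #|S| = k &
      forall S', S' \subset vertices G -> #|S'| = k ->
        induced_edges G S <= induced_edges G S'].

Lemma block_deletion_set_vertices G : block_deletion_set G (vertices G).
Proof.
rewrite /block_deletion_set subxx; apply/forallP => H; apply/implyP.
case/and3P=> /and3P[_ sHV _] /andP[/eqP cH _] _; move: cH.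
suff V0 : vertices H = set0.
  rewrite /components V0 (eq_n_comp_r (a' := pred0)) => [|x]; last by rewrite inE.
  by rewrite /n_comp_mem eq_card0 // => x; rewrite !inE andbF.
by apply/eqP; rewrite -subset0; move: sHV; rewrite /vertices /= setICr.
Qed.

End Graphs.

(* Model of computation: a word RAM programmed in a structured language.
   The memory consists of scalar registers and of arrays of words; a program
   mentions finitely many of them, and can address array cells by computed
   indices. Words are the naturals below the word bound W. Evaluation is
   undefined as soon as some operand or intermediate result is not a word, so a
   terminating run never overflows. Every elementary operation, literal and
   memory access takes one time unit. *)
Inductive binop := OpAdd | OpSub | OpMul | OpDiv | OpMod | OpEq | OpLt.

Inductive expr :=
  | Lit of nat
  | Reg of nat
  | Get of nat & expr
  | Bin of binop & expr & expr.

Inductive prog :=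
  | Skip
  | Assign of nat & expr
  | Put of nat & expr & expr
  | Seq of prog & prog
  | If of expr & prog & prog
  | While of expr & prog.

Record store := Store { reg : nat -> nat; arr : nat -> nat -> nat }.

(* OpSub is truncated; division by 0 yields 0. *)
Definition binop_val (o : binop) (u v : nat) : nat :=
  match o with
  | OpAdd => u + v
  | OpSub => u - v
  | OpMul => u * v
  | OpDiv => u %/ v
  | OpMod => u %% v
  | OpEq => u == v
  | OpLt => u < v
  end.

Definition word (W v : nat) : option nat := if v < W then Some v else None.

Fixpoint eval (W : nat) (s : store) (e : expr) : option nat :=
  match e with
  | Lit v => word W v
  | Reg x => word W (reg s x)
  | Get a i => obind (fun u => word W (arr s a u)) (eval W s i)
  | Bin o e1 e2 =>
      obind (fun u => obind (fun v => word W (binop_val o u v)) (eval W s e2))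
            (eval W s e1)
  end.

Fixpoint cost (e : expr) : nat :=
  match e with
  | Lit _ | Reg _ => 1
  | Get _ i => (cost i).+1
  | Bin _ e1 e2 => (cost e1 + cost e2).+1
  end.

Definition upd (V : Type) (f : nat -> V) (x : nat) (v : V) : nat -> V :=
  fun y => if y == x then v else f y.

Definition set_reg (s : store) (x v : nat) : store :=
  Store (upd (reg s) x v) (arr s).

Definition set_arr (s : store) (a i v : nat) : store :=
  Store (reg s) (upd (arr s) a (upd (arr s a) i v)).

(* [exec W p s t s'] : started in s, the program p halts in s' after t units. *)
Inductive exec (W : nat) : prog -> store -> nat -> store -> Prop :=
  | ExecSkip s : exec W Skip s 1 s
  | ExecAssign s x e v :
      eval W s e = Some v ->
      exec W (Assign x e) s (cost e).+1 (set_reg s x v)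
  | ExecPut s a e1 e2 i v :
      eval W s e1 = Some i -> eval W s e2 = Some v ->
      exec W (Put a e1 e2) s (cost e1 + cost e2).+1 (set_arr s a i v)
  | ExecSeq p q s s1 s2 t1 t2 :
      exec W p s t1 s1 -> exec W q s1 t2 s2 ->
      exec W (Seq p q) s (t1 + t2) s2
  | ExecIf b p q s s' v t :
      eval W s b = Some v -> exec W (if v != 0 then p else q) s t s' ->
      exec W (If b p q) s ((cost b).+1 + t) s'
  | ExecWhileStop b p s :
      eval W s b = Some 0 -> exec W (While b p) s (cost b).+1 s
  | ExecWhileLoop b p s s1 s2 v t1 t2 :
      eval W s b = Some v -> v != 0 ->
      exec W p s t1 s1 -> exec W (While b p) s1 t2 s2 ->
      exec W (While b p) s ((cost b).+1 + t1 + t2) s2.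

(* Adjacency lists, in an arbitrary order. *)
Definition adjacency_lists n (G : graph 'I_n) (adj : 'I_n -> seq 'I_n) : Prop :=
  forall v, perm_eq (adj v) (enum [set u | adjacent G v u]).

(* Registers 0, 1, 2 hold n, k and the length of the list ds of the elements of
   the deletion set. Array 1 is the concatenation of the adjacency lists, that
   of vertex v occupying the cells from (array 0)[v] to (array 0)[v + 1],
   excluded; array 2 is ds. All other memory is 0. *)
Definition input n (adj : 'I_n -> seq 'I_n) (k : nat) (ds : seq 'I_n) : store :=
  let lists := [seq [seq val u | u <- adj v] | v <- enum 'I_n] in
  let offsets := mkseq (fun i => sumn (take i (map size lists))) n.+1 in
  Store (nth 0 [:: n; k; size ds])
        (fun a => nth 0 (nth [::] [:: offsets; flatten lists; map val ds] a)).

(* Register 0 tells whether there is a vertex set of size k at all; if so, the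
   cells 0, ..., k - 1 of array 0 enumerate the solution without repetition. *)
Definition answers n (P : {set 'I_n} -> Prop) (k : nat) (s : store) : Prop :=
  if k <= n then
    reg s 0 = 1 /\
    exists2 S : {set 'I_n}, P S & perm_eq (mkseq (arr s 0) k) (map val (enum S))
  else reg s 0 = 0.

(* On the input (G, k, D), for every presentation of G and D, the program
   halts with a solution of P within time t, provided that words have at least
   c * log (n + k + 1) + log c bits. *)
Definition solves_within (p : prog) (c n : nat) (G : graph 'I_n) (k : nat)
    (D : {set 'I_n}) (P : {set 'I_n} -> Prop) (t : nat) : Prop :=
  forall (adj : 'I_n -> seq 'I_n) (ds : seq 'I_n) (W : nat),
    adjacency_lists G adj -> perm_eq ds (enum D) ->
    c * (n + k + 1) ^ c <= W ->
    exists t' s', [/\ exec W p (input adj k ds) t' s', t' <= t & answers P k s'].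

(* Main.v *)
Require Import Defs.
From mathcomp Require Import all_boot.
From mathcomp Require Import zify.

(** Fix the trace X of the solution on the deletion set D, and order the vertices
    so that D comes first and is followed by G - D in the order of a graph
    search. Every cycle of a block graph spans a clique; hence, if t is the
    latest earlier neighbour of v in G - D, the set A(v) of the earlier
    neighbours of v in G - D is empty, or {t}, or {t} together with A(t). Count
    an edge at its later end: the contribution of a selected vertex v is the
    number of its earlier neighbours in X, plus the number of selected vertices
    in A(v), and the latter is a function of the same number for t and of
    whether t is selected. A dynamic program with O(k^2) entries per vertex
    therefore folds the vertices, from the last one to the second, into their t,
    in O(k^3) each. At every stage the optimum is the maximum, over the
    selections among the remaining vertices and over the ways to distribute the
    cardinality k among them, of the sum of their table entries; this invariant
    needs no reference to subtrees, and the folded choices give back an optimal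
    selection. Each of the 2^|D| traces thus costs O(k^3 n + m). *)

Set Implicit Arguments.
Unset Strict Implicit.
Unset Printing Implicit Defensive.

(** * Time-bounded verification of word RAM programs *)

(** The running time is exponential in |D| while words have only logarithmic length, so programs are
    analysed in an idealised semantics without word bound, in which only the stored values must stay
    below some [B] cubic in n + k + 1. Expressions of bounded cost then have intermediate results
    polynomial in [B]. Natural numbers offer no minus infinity for infeasible choices. Infeasible
    local entries are 0 instead, and feasible ones carry a bonus, so that the size of the optimum
    alone reveals whether a trace admits a selection of k vertices. Sparsest subgraphs are found by
    the same maximisation, each selected vertex being worth n minus its count. Of the search order
    only one property matters: two vertices of a prefix that lie in one component are already
    connected inside the prefix. The forest of parents is made into a single tree by giving parent 0
    to every vertex without earlier neighbours in G - D; its context is empty, so this link carries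
    no information besides the cardinality. *)

Fixpoint pval (s : store) (e : expr) : nat :=
  match e with
  | Lit v => v
  | Reg x => reg s x
  | Get a i => arr s a (pval s i)
  | Bin o e1 e2 => binop_val o (pval s e1) (pval s e2)
  end.

Definition bounded (B : nat) (s : store) : Prop :=
  (forall x, reg s x < B) /\ (forall a i, arr s a i < B).

Fixpoint small_lits (m : nat) (e : expr) : bool :=
  match e with
  | Lit v => v < m
  | Reg _ => true
  | Get _ i => small_lits m i
  | Bin _ e1 e2 => small_lits m e1 && small_lits m e2
  end.

(** The shift by 2 lets a product dominate every operation. A shift by 1 would fail for a true
    comparison of zeros, whose value is 1. *)
Lemma binop_val_bound o u v : (binop_val o u v).+2 <= u.+2 * v.+2.
Proof.
by case: o => /=; move: (leq_div u v) (leq_mod u v); nia.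
Qed.

Lemma pval_bound B m s e : bounded B s -> m <= B -> small_lits m e ->
  (pval s e).+2 <= B.+2 ^ cost e.
Proof.
move=> [Br Ba] mB; elim: e => [v|x|a i IH|o e1 IH1 e2 IH2] /=.
- by move=> vm; rewrite expn1; lia.
- by move=> _; rewrite expn1; move: (Br x); lia.
- move=> _; apply: (@leq_trans (B.+2 ^ 1)); first by rewrite expn1; move: (Ba a (pval s i)); lia.
  by apply: leq_pexp2l.
- case/andP=> /IH1 h1 /IH2 h2; apply: (leq_trans (binop_val_bound o _ _)).
  apply: (leq_trans (leq_mul h1 h2)); rewrite -expnD.
  by apply: leq_pexp2l => //; lia.
Qed.

Lemma eval_pval W B m s e : bounded B s -> m <= B -> small_lits m e ->
  B.+2 ^ cost e <= W -> eval W s e = Some (pval s e).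
Proof.
move=> bs mB; elim: e => [v|x|a i IH|o e1 IH1 e2 IH2] /=.
- by rewrite expn1 /word => vm BW; rewrite ifT //; lia.
- by rewrite expn1 /word => _ BW; rewrite ifT //; move: (bs.1 x); lia.
- move=> li BW; rewrite IH //= /word; last by apply: leq_trans BW; apply: leq_pexp2l.
  rewrite ifT //; move: (bs.2 a (pval s i)) (leq_pexp2l (ltn0Sn B.+1) (ltn0Sn (cost i))).
  by rewrite expn1; lia.
- case/andP=> l1 l2 BW.
  have W1 : B.+2 ^ cost e1 <= W by apply: leq_trans BW; apply: leq_pexp2l => //; lia.
  have W2 : B.+2 ^ cost e2 <= W by apply: leq_trans BW; apply: leq_pexp2l => //; lia.
  rewrite IH1 ?IH2 //= /word ifT //; apply: leq_trans BW.
  apply: ltnW; apply: (leq_trans (binop_val_bound o _ _)).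
  apply: leq_trans (leq_mul (pval_bound bs mB l1) (pval_bound bs mB l2)) _.
  by rewrite -expnD; apply: leq_pexp2l => //; lia.
Qed.

(* Execution without words: the values that get stored are below B, which keeps
   every intermediate result polynomial in B. *)
Inductive run (B : nat) : prog -> store -> nat -> store -> Prop :=
  | RunSkip s : run B Skip s 1 s
  | RunAssign s x e :
      pval s e < B -> run B (Assign x e) s (cost e).+1 (set_reg s x (pval s e))
  | RunPut s a e1 e2 :
      pval s e2 < B ->
      run B (Put a e1 e2) s (cost e1 + cost e2).+1
          (set_arr s a (pval s e1) (pval s e2))
  | RunSeq p q s s1 s2 t1 t2 :
      run B p s t1 s1 -> run B q s1 t2 s2 -> run B (Seq p q) s (t1 + t2) s2
  | RunIf b p q s s' t :
      run B (if pval s b != 0 then p else q) s t s' ->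
      run B (If b p q) s ((cost b).+1 + t) s'
  | RunWhileStop b p s :
      pval s b = 0 -> run B (While b p) s (cost b).+1 s
  | RunWhileLoop b p s s1 s2 t1 t2 :
      pval s b != 0 -> run B p s t1 s1 -> run B (While b p) s1 t2 s2 ->
      run B (While b p) s ((cost b).+1 + t1 + t2) s2.

Fixpoint exprs (p : prog) : seq expr :=
  match p with
  | Skip => [::]
  | Assign _ e => [:: e]
  | Put _ e1 e2 => [:: e1; e2]
  | Seq p q => exprs p ++ exprs q
  | If b p q => b :: exprs p ++ exprs q
  | While b p => b :: exprs p
  end.

Definition small_exprs (m c : nat) (p : prog) : bool :=
  all (fun e => small_lits m e && (cost e <= c)) (exprs p).

Lemma bounded_set_reg B s x v : bounded B s -> v < B -> bounded B (set_reg s x v).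
Proof. by case=> Br Ba vB; split=> // y; rewrite /= /upd; case: eqP. Qed.

Lemma bounded_set_arr B s a i v : bounded B s -> v < B -> bounded B (set_arr s a i v).
Proof.
case=> Br Ba vB; split=> // y j; rewrite /= /upd; case: eqP => // _.
by case: eqP.
Qed.

(** One exponent [c] bounds the cost of all expressions of the program, hence all intermediate
    results; the required word size is therefore independent of the number [t] of steps. *)
Lemma run_exec W B m c p s t s' :
  m <= B -> B.+2 ^ c <= W -> small_exprs m c p -> bounded B s ->
  run B p s t s' -> exec W p s t s' /\ bounded B s'.
Proof.
move=> mB BW sp bs r; elim: r sp bs => {p s t s'}.
- by move=> s _ bs; split=> //; constructor.
- move=> s x e eB; rewrite /small_exprs /= andbT => /andP[le ce] bs.
  split; last exact: bounded_set_reg.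
  constructor; apply: eval_pval bs mB le _; apply: leq_trans BW; exact: leq_pexp2l.
- move=> s a e1 e2 eB; rewrite /small_exprs /= andbT => /andP[/andP[l1 c1] /andP[l2 c2]] bs.
  split; last exact: bounded_set_arr.
  by constructor; apply: eval_pval bs mB _ _ => //; apply: leq_trans BW; exact: leq_pexp2l.
- move=> p q s s1 s2 t1 t2 _ IH1 _ IH2; rewrite /small_exprs /= all_cat.
  case/andP=> sp sq bs; have [e1 b1] := IH1 sp bs; have [e2 b2] := IH2 sq b1.
  by split=> //; apply: ExecSeq e1 e2.
- move=> b p q s s' t _ IH; rewrite /small_exprs /= all_cat.
  case/andP=> /andP[lb cb] /andP[sp sq] bs.
  have [||e b'] := IH; rewrite ?if_arg //; first by case: ifP.
  split=> //; apply: (@ExecIf _ _ _ _ _ _ (pval s b)) => //.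
  by apply: eval_pval bs mB lb _; apply: leq_trans BW; exact: leq_pexp2l.
- move=> b p s b0 /= /andP[/andP[lb cb] sp] bs; split=> //; apply: ExecWhileStop.
  by rewrite -b0; apply: eval_pval bs mB lb _; apply: leq_trans BW; exact: leq_pexp2l.
- move=> b p s s1 s2 t1 t2 b0 _ IH1 _ IH2 sw bs.
  have /= /andP[/andP[lb cb] sp] := sw.
  have [e1 b1] := IH1 sp bs; have [e2 b2] := IH2 sw b1; split=> //.
  apply: ExecWhileLoop b0 e1 e2.
  by apply: eval_pval bs mB lb _; apply: leq_trans BW; exact: leq_pexp2l.
Qed.

Fixpoint mod_regs (p : prog) : seq nat :=
  match p with
  | Skip | Put _ _ _ => [::]
  | Assign x _ => [:: x]
  | Seq p q | If _ p q => mod_regs p ++ mod_regs q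
  | While _ p => mod_regs p
  end.

Fixpoint mod_arrs (p : prog) : seq nat :=
  match p with
  | Skip | Assign _ _ => [::]
  | Put a _ _ => [:: a]
  | Seq p q | If _ p q => mod_arrs p ++ mod_arrs q
  | While _ p => mod_arrs p
  end.

(** A syntactic footprint. The loop rules supply it along with the invariant, so that an invariant
    need mention only what the body changes. *)
Definition frame (p : prog) (s s' : store) : Prop :=
  (forall x, x \notin mod_regs p -> reg s' x = reg s x) /\
  (forall a, a \notin mod_arrs p -> arr s' a = arr s a).

Lemma frame_trans p s1 s2 s3 : frame p s1 s2 -> frame p s2 s3 -> frame p s1 s3.
Proof.
move=> [r12 a12] [r23 a23]; split=> [x xp|a ap].
  by rewrite r23 ?r12.
by rewrite a23 ?a12.
Qed.

Lemma run_frame B p s t s' : run B p s t s' -> frame p s s'.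
Proof.
elim=> {p s t s'} //.
- by move=> s x e _; split=> //= y; rewrite inE /upd => /negPf->.
- by move=> s a e1 e2 _; split=> //= y; rewrite inE /upd => /negPf->.
- move=> p q s s1 s2 _ _ _ [r1 a1] _ [r2 a2].
  by split=> /= [x|a]; rewrite mem_cat => /norP[h1 h2]; rewrite ?r2 ?r1 ?a2 ?a1.
- move=> b p q s s' _ _ [r1 a1].
  by split=> /= [x|a]; rewrite mem_cat => /norP[h1 h2]; rewrite ?r1 ?a1 //; case: ifP.
- by move=> b p s s1 s2 _ _ _ _ f1 _ f2; apply: frame_trans f1 f2.
Qed.

(** * Weakest preconditions with running time *)

Section Wp.
Variable B : nat.

Definition wp (p : prog) (s : store) (Q : nat -> store -> Prop) : Prop :=
  exists t s', run B p s t s' /\ Q t s'.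

Lemma wp_conseq p s (Q R : nat -> store -> Prop) :
  wp p s Q -> (forall t s', frame p s s' -> Q t s' -> R t s') -> wp p s R.
Proof.
case=> t [s' [r q]] QR; exists t, s'; split=> //; apply: QR q; exact: run_frame r.
Qed.

Lemma wp_skip s (Q : nat -> store -> Prop) : Q 1 s -> wp Skip s Q.
Proof. by exists 1, s; split=> //; constructor. Qed.

Lemma wp_assign x e s (Q : nat -> store -> Prop) :
  pval s e < B -> Q (cost e).+1 (set_reg s x (pval s e)) -> wp (Assign x e) s Q.
Proof. by move=> eB q; do 2 eexists; split; [constructor|]. Qed.

Lemma wp_put a e1 e2 s (Q : nat -> store -> Prop) :
  pval s e2 < B -> Q (cost e1 + cost e2).+1 (set_arr s a (pval s e1) (pval s e2)) ->
  wp (Put a e1 e2) s Q.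
Proof. by move=> eB q; do 2 eexists; split; [constructor|]. Qed.

Lemma wp_seq p q s (Q : nat -> store -> Prop) :
  wp p s (fun t s' => wp q s' (fun t' => Q (t + t'))) -> wp (Seq p q) s Q.
Proof.
move=> [t [s' [r [t' [s2 [r' q']]]]]]; exists (t + t'), s2.
by split=> //; apply: RunSeq r r'.
Qed.

Lemma wp_if b p q s (Q : nat -> store -> Prop) :
  (pval s b != 0 -> wp p s (fun t => Q ((cost b).+1 + t))) ->
  (pval s b = 0 -> wp q s (fun t => Q ((cost b).+1 + t))) ->
  wp (If b p q) s Q.
Proof.
move=> hp hq; have: wp (if pval s b != 0 then p else q) s (fun t => Q ((cost b).+1 + t)).
  by case: ifP => [/hp //|/negbFE /eqP /hq].
by case=> t [s' [r q']]; exists ((cost b).+1 + t), s'; split=> //; constructor.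
Qed.

(* In the invariant [I l T s], l counts the iterations done and T is the time
   that they took. *)
Lemma wp_while b p s l0 N (I : nat -> nat -> store -> Prop) (Q : nat -> store -> Prop) :
  l0 <= N -> I l0 0 s ->
  (forall l T s', l0 <= l <= N -> I l T s' -> frame p s s' -> (pval s' b != 0) = (l < N)) ->
  (forall l T s', l0 <= l < N -> I l T s' -> frame p s s' ->
     wp p s' (fun t => I l.+1 (T + t + (cost b).+1))) ->
  (forall T s', I N T s' -> frame p s s' -> Q (T + (cost b).+1) s') ->
  wp (While b p) s Q.
Proof.
move=> lN I0 hb hp hQ.
have frefl : frame p s s by [].
suff: forall m l T s', N - l = m -> l0 <= l <= N -> I l T s' -> frame p s s' ->
    wp (While b p) s' (fun t => Q (T + t)).
  by move/(_ _ l0 0 s erefl); apply; rewrite ?leqnn.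
elim=> [|m IH] l T s' Nl ll Il fr.
  have Nl' : l = N by lia.
  exists (cost b).+1, s'; split; last by apply: hQ; rewrite -?Nl'.
  by constructor; apply/eqP; move: (hb _ _ _ ll Il fr); rewrite Nl' ltnn => /negbFE.
have ll' : l0 <= l < N by lia.
have [t [s1 [r I1]]] := hp _ _ _ ll' Il fr.
have [|||t2 [s2 [r2 q2]]] := IH l.+1 _ s1 _ _ I1; try lia.
  by apply: frame_trans fr (run_frame r).
exists ((cost b).+1 + t + t2), s2; split; last by move: q2; congr Q; lia.
apply: RunWhileLoop r r2; rewrite (hb _ _ _ _ Il fr); lia.
Qed.

Definition For (x : nat) (lo hi : expr) (p : prog) : prog :=
  Seq (Assign x lo)
      (While (Bin OpLt (Reg x) hi) (Seq p (Assign x (Bin OpAdd (Reg x) (Lit 1))))).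

(** An iteration adds [cost hi + 7] to its body: 4 for the increment and [cost hi + 3] for the test,
    which evaluates [hi] anew. The initial assignment and the failing test make up the remaining
    [cost lo + cost hi + 4]. *)
Lemma wp_for (x : nat) lo hi p s N (I : nat -> nat -> store -> Prop) (Q : nat -> store -> Prop) :
  x \notin mod_regs p -> pval s lo <= N -> N < B ->
  I (pval s lo) 0 (set_reg s x (pval s lo)) ->
  (forall l T s', pval s lo <= l <= N -> I l T s' -> reg s' x = l ->
     frame (For x lo hi p) s s' -> pval s' hi = N) ->
  (forall l T s', pval s lo <= l < N -> I l T s' -> reg s' x = l ->
     frame (For x lo hi p) s s' ->
     wp p s' (fun t s2 => I l.+1 (T + t + (cost hi + 7)) (set_reg s2 x l.+1))) ->
  (forall T s', I N T s' -> reg s' x = N ->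
     frame (For x lo hi p) s s' -> Q (cost lo + cost hi + T + 4) s') ->
  wp (For x lo hi p) s Q.
Proof.
move=> xp lN NB I0 hhi hp hQ; apply: wp_seq; apply: wp_assign; first lia.
set s0 := set_reg s x _ in I0 *.
have f0 : frame (For x lo hi p) s s0.
  by split=> //= y; rewrite inE /upd => /norP[/negPf-> _].
have fW s' : frame (Seq p (Assign x (Bin OpAdd (Reg x) (Lit 1)))) s0 s' ->
    frame (For x lo hi p) s s'.
  move=> [fr fa]; apply: frame_trans f0 _.
  split=> [y yp|a ap]; [apply: fr|apply: fa].
    by apply: contra yp; rewrite /= mem_cat !inE => /orP[]h; rewrite ?mem_cat ?inE h ?orbT.
  by apply: contra ap; rewrite /= !mem_cat.
apply: (@wp_while _ _ _ (pval s lo) N (fun l T s' => I l T s' /\ reg s' x = l)) => //.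
- by split=> //; rewrite /= /upd eqxx.
- move=> l T s' ll [Il rx] fr /=; rewrite rx (hhi _ _ _ ll Il rx (fW _ fr)).
  by case: (l < N).
- move=> l T s' ll [Il rx] fr; apply: wp_seq.
  apply: wp_conseq (hp _ _ _ ll Il rx (fW _ fr)) _ => t s2 f2 I2.
  have rx2 : reg s2 x = l by rewrite f2.1.
  apply: wp_assign => /=; rewrite rx2 ?(addn1 l); first lia.
  split; last by rewrite /upd eqxx.
  by rewrite (_ : _ + _ + _ = T + t + (cost hi + 7)) //; lia.
- move=> T s' [IN rx] fr /=; move: (hQ _ _ IN rx (fW _ fr)); congr Q; lia.
Qed.

End Wp.

(** * Cycles and search orders of block graphs *)

Section GraphTheory.
Variable T : finType.
Implicit Types (G H K : graph T) (S D : {set T}) (x y : T).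

Lemma adjacent_sym G : symmetric (adjacent G).
Proof. by move=> x y; rewrite /adjacent setUC. Qed.

Lemma adjacent_vertices G x y : simple_graph G -> adjacent G x y ->
  [/\ x \in vertices G, y \in vertices G & x != y].
Proof.
move=> /subsetP sG /sG; rewrite inE cards2 => /andP[/subsetP sV].
by rewrite !sV ?inE ?eqxx ?orbT //; case: (x != y).
Qed.

Lemma simple_induced G S : simple_graph G -> simple_graph (induced G S).
Proof.
move=> /subsetP sG; apply/subsetP => A; rewrite inE => /andP[/sG].
by rewrite !inE => /andP[AV ->] AS; rewrite andbT subsetI AV.
Qed.

Lemma adjacent_induced G S x y :
  adjacent (induced G S) x y = [&& adjacent G x y, x \in S & y \in S].
Proof. by rewrite /adjacent inE subUset !sub1set. Qed.

Lemma subgraph_refl G : simple_graph G -> subgraph G G.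
Proof. by rewrite /subgraph => ->; rewrite !subxx. Qed.

Lemma subgraph_trans G H K : subgraph G H -> subgraph H K -> subgraph G K.
Proof.
by move=> /and3P[sG v1 e1] /and3P[_ v2 e2]; rewrite /subgraph sG (subset_trans v1) ?(subset_trans e1).
Qed.

Lemma subgraph_induced G S : simple_graph G -> subgraph (induced G S) G.
Proof.
move=> sG; rewrite /subgraph simple_induced // subsetIl /=.
by apply/subsetP => A; rewrite inE => /andP[].
Qed.

Lemma components1 G x : simple_graph G -> x \in vertices G ->
  {in vertices G, forall y, connect (adjacent G) x y} -> components G = 1.
Proof.
move=> sG xV cG; rewrite /components.
have cs : connect_sym (adjacent G) by apply: sym_connect_sym; exact: adjacent_sym.
rewrite -[RHS](n_comp_connect cs x); apply: eq_n_comp_r => y; apply/idP/idP.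
  exact: cG.
case/connectP=> p; case/lastP: p => [_ -> //|p z]; rewrite rcons_path last_rcons.
by case/andP=> _ /(adjacent_vertices sG)[_ zV _] ->.
Qed.

Lemma components0 G : vertices G = set0 -> components G = 0.
Proof.
move=> V0; rewrite /components (eq_n_comp_r (a' := pred0)) => [|x]; last by rewrite V0 inE.
by rewrite /n_comp_mem eq_card0 // => x; rewrite !inE andbF.
Qed.

(* A nonseparable subgraph extends to a block, which is a clique. *)
Lemma block_graph_complete G H : block_graph G -> subgraph H G -> nonseparable H ->
  {in vertices H &, forall x y, x != y -> adjacent G x y}.
Proof.
move=> bG HG nH.
pose P K := [&& subgraph K G, nonseparable K & subgraph H K].
have sH : simple_graph H by case/and3P: HG.
have PH : P H by rewrite /P HG nH subgraph_refl.
(* Maximality of this sum implies maximality for [subgraph]: an extension with the same sum has the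
   same vertices and the same edges. *)
case: (@arg_maxnP _ H P (fun K => #|vertices K| + #|edges K|) PH) => K PK maxK.
have [KG nK HK] := and3P PK.
have bK : block G K.
  rewrite /block KG nK; apply/forallP => L; apply/implyP => /and3P[LG nL KL].
  have := maxK L; rewrite /P LG nL (subgraph_trans HK KL) => /(_ isT).
  have [_ sV sE] := and3P KL.
  move=> cL; have cV := subset_leq_card sV; have cE := subset_leq_card sE.
  have {}cL : #|vertices L| + #|edges L| <= #|vertices K| + #|edges K| by exact: cL.
  have eV : vertices K == vertices L.
    by rewrite eqEcard sV -(leq_add2r #|edges L|) (leq_trans cL) // leq_add2l.
  have eE : edges K == edges L.
    by rewrite eqEcard sE -(leq_add2l #|vertices L|) (leq_trans cL) // leq_add2r.
  by rewrite [L]surjective_pairing [K]surjective_pairing xpair_eqE eq_sym eV eq_sym eE.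
have /implyP /(_ bK) /eqP cK := forallP bG K.
have [_ HVK _] := and3P HK; have [_ _ KE] := and3P KG.
move=> x y xH yH xy; apply: (subsetP KE); rewrite cK inE cards2 xy andbT.
by rewrite subUset !sub1set !(subsetP HVK).
Qed.

Lemma connect_path_mem (e : rel T) x p : symmetric e -> path e x p ->
  {in x :: p &, forall y z,
     connect [rel u v | [&& e u v, u \in x :: p & v \in x :: p]] y z}.
Proof.
move=> se ep; set e' := [rel u v | _].
have cs : connect_sym e'.
  apply: sym_connect_sym => u v /=; rewrite se.
  by case: (u \in _); case: (v \in _).
have cx y : y \in x :: p -> connect e' x y.
  move=> my; have: path e' x p.
    apply: (@sub_in_path _ (mem (x :: p)) e) ep; last by apply/allP.
    by move=> u v um vm /= ->; rewrite um vm.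
  by move/path_connect; apply.
move=> y z /cx cy /cx cz; apply: connect_trans cz; by rewrite cs.
Qed.

(** The subgraph induced by the vertices of a cycle is nonseparable, because deleting one of them
    leaves a path through the others. *)
Lemma block_graph_cycle G c : simple_graph G -> block_graph G -> uniq c ->
  cycle (adjacent G) c -> {in c &, forall x y, x != y -> adjacent G x y}.
Proof.
move=> sG bG; case: c => [//|x p] uc cc.
have [ep el] : path (adjacent G) x p /\ adjacent G (last x p) x.
  by move: cc; rewrite /= rcons_path => /andP[].
have cV : {subset x :: p <= vertices G}.
  move=> y; rewrite inE => /predU1P[->|yp]; first by have [] := adjacent_vertices sG el.
  case/splitPr: yp ep => p1 p2; rewrite cat_path /= => /and3P[_ ey _].
  by have [] := adjacent_vertices sG ey.
pose H := induced G [set y in x :: p].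
have sH : simple_graph H by exact: simple_induced.
have VH y : (y \in vertices H) = (y \in x :: p).
  by rewrite in_setI [_ \in [set _ in _]]inE; case yc: (y \in x :: p); rewrite ?andbT ?andbF ?cV.
suff nH : nonseparable H.
  move=> y z yc zc; apply: block_graph_complete (subgraph_induced _ sG) nH _ _ _ _ => //.
    by rewrite VH.
  by rewrite VH.
have H1 : components H = 1.
  apply: (@components1 _ x) => //; first by rewrite VH mem_head.
  move=> y; rewrite VH => yc.
  apply: connect_sub (connect_path_mem (@adjacent_sym G) ep (mem_head _ _) yc).
  move=> u v /= /and3P[euv um vm]; apply: connect1.
  by rewrite adjacent_induced euv !inE -!in_cons um vm.
apply/andP; split; first by rewrite /connected_graph H1.
apply/forallP => z; rewrite /cut_vertex; case zV: (z \in vertices H) => //=.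
rewrite H1 -leqNgt; move: zV; rewrite VH => zc.
(* Rotated to start at the deleted vertex [z], the cycle leaves the path [q] through all other
   vertices. *)
have [i q eq_c] := rot_to zc.
have: cycle (adjacent G) (z :: q) by rewrite -eq_c rot_cycle.
have: uniq (z :: q) by rewrite -eq_c rot_uniq.
have mq y : (y \in x :: p) = (y \in z :: q) by rewrite -eq_c mem_rot.
pose K := delete H [set z].
have VK y : (y \in vertices K) = (y \in q) && (y != z).
  rewrite /K /delete /induced /= in_setI VH mq !inE.
  by case: eqP => //=; rewrite ?andbF ?andbT.
rewrite cons_uniq => /andP[zq _].
case: q eq_c mq VK zq => [|y q] _ mq VK zq.
  by move=> _; rewrite components0 //; apply/setP => u; rewrite VK inE.
rewrite /= rcons_path => /andP[_ /andP[eq _]].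
rewrite (@components1 K y) //; first by apply: simple_induced.
  by rewrite VK mem_head; apply: contraNneq zq => ->; rewrite mem_head.
move=> u; rewrite VK => /andP[uq _].
apply: connect_sub (connect_path_mem (@adjacent_sym G) eq (mem_head _ _) uq).
move=> v w /= /and3P[evw vq wq]; apply: connect1.
rewrite !adjacent_induced evw !inE -!in_cons !mq.
rewrite ![_ \in z :: _]inE vq wq !orbT /=.
by apply/andP; split; [apply: contraNneq zq => <-|apply: contraNneq zq => <-].
Qed.

(** Orienting each edge from its earlier to its later end makes the ordered pair recoverable from
    the set of its two elements. This turns edge counts into sums over later ends. *)
Lemma pairs_below (pos : T -> nat) : injective pos -> forall G S, simple_graph G ->
  #|[set xy : T * T | [&& adjacent G xy.1 xy.2, pos xy.1 < pos xy.2, xy.1 \in S & xy.2 \in S]]|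
  = induced_edges G S.
Proof.
move=> ip G S sG; rewrite /induced_edges -(card_in_imset (f := fun xy => [set xy.1; xy.2])).
  apply: eq_card => A; apply/imsetP/idP => [[[x y]]|].
    rewrite !inE /= => /and4P[exy _ xS yS] ->; rewrite subUset !sub1set xS yS /= andbT; exact: exy.
  rewrite /edges /= inE => /andP[AE AS].
  have /[!inE] /andP[_ /cards2P[x [y [xy eA]]]] := subsetP sG _ AE.
  move: AE AS; rewrite eA subUset !sub1set => AE /andP[xS yS].
  have [pxy|pyx|/ip exy] := ltngtP (pos x) (pos y); last by rewrite exy eqxx in xy.
    by exists (x, y); rewrite // inE /= pxy xS yS /adjacent AE.
  by exists (y, x); rewrite 1?setUC // inE /= pyx xS yS /adjacent setUC AE.
move=> [x y] [x' y']; rewrite !inE /= => /and4P[_ pxy _ _] /and4P[_ pxy' _ _] /setP eq_s.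
have := eq_s x; have := eq_s y; rewrite !inE !eqxx /= ?orbT.
move=> /esym /orP[]/eqP ey /esym /orP[]/eqP ex; subst x y => //.
- by rewrite ltnn in pxy.
- by move: (ltn_trans pxy pxy'); rewrite ltnn.
- by rewrite ltnn in pxy.
Qed.

End GraphTheory.

(** * Earlier neighbours in a search order of a block graph *)

Section SearchOrder.
Variables (T : finType) (G : graph T) (pos : T -> nat).
Hypothesis sG : simple_graph G.
Hypothesis bG : block_graph G.
Hypothesis pos_inj : injective pos.
Local Notation e := (adjacent G).
Hypothesis search : forall v,
  (forall x y, pos x < pos v -> e x y -> pos y < pos v) \/
  (exists w, pos w < pos v /\ e w v).

(** Induction on the prefix. Its last vertex either opens a component, and then nothing before it is
    connected to it, or it has a neighbour earlier in the prefix, from which the induction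
    hypothesis continues. *)
Lemma prefix_connect p u v : pos u < p -> pos v < p -> connect e u v ->
  connect [rel x y | [&& e x y, pos x < p & pos y < p]] u v.
Proof.
have sube q : forall x y, connect [rel x y | [&& e x y, pos x < q & pos y < q]] x y ->
    connect [rel x y | [&& e x y, pos x < q.+1 & pos y < q.+1]] x y.
  apply: connect_sub => x y /= /and3P[exy xq yq].
  by apply: connect1; rewrite /= exy !(ltn_trans _ (ltnSn q)).
have cs q : connect_sym [rel x y | [&& e x y, pos x < q & pos y < q]].
  by apply: sym_connect_sym => x y /=; rewrite adjacent_sym; do 2 case: (_ < q).
elim: p u v => [//|p IH] u v.
suff main x z : pos x = p -> pos z < p -> connect e x z ->
    connect [rel x y | [&& e x y, pos x < p.+1 & pos y < p.+1]] x z.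
  rewrite !ltnS (leq_eqVlt (pos u)) (leq_eqVlt (pos v)) => /predU1P[up|up] /predU1P[vp|vp] cuv.
  - by have /pos_inj-> : pos u = pos v by rewrite up vp.
  - exact: main.
  - rewrite cs; apply: main => //; by rewrite (sym_connect_sym (@adjacent_sym _ G)).
  - by apply: sube; apply: IH.
move=> xp zp cxz; case: (search x) => [cl|[w [wx ewx]]].
  have cl' : closed e [pred y | pos y < pos x].
    apply: intro_closed; first exact: sym_connect_sym (@adjacent_sym _ G).
    by move=> y y' eyy' /= /cl; apply.
  by have := closed_connect cl' cxz; rewrite !inE ltnn xp zp.
rewrite xp in wx; apply: (@connect_trans _ _ w).
  by apply: connect1; rewrite /= adjacent_sym ewx xp ltnSn (ltn_trans wx).
apply: sube; apply: IH => //; apply: connect_trans cxz; exact: connect1.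
Qed.

(** Both are connected through [v], hence already by a path before [v], and [v] closes this path to
    a cycle. *)
Lemma earlier_adjacent v u w : e u v -> e w v -> pos u < pos v -> pos w < pos v ->
  u != w -> e u w.
Proof.
move=> euv ewv uv wv uw.
have /(prefix_connect uv wv)/connectP[p0 ep0] : connect e u w.
  by apply: (connect_trans (connect1 euv)); apply: connect1; rewrite adjacent_sym.
(* [block_graph_cycle] asks for a cycle without repetition. *)
case/shortenP: ep0 => p ep up _ {p0} lw.
have mp x : x \in u :: p -> pos x < pos v.
  rewrite inE => /predU1P[->//|]; elim: p u ep {up lw uv euv uw} => //= y p IH u.
  case/andP=> /and3P[_ _ yv] ep; rewrite inE => /predU1P[->//|]; exact: IH ep.
apply: (block_graph_cycle (c := v :: u :: p) sG bG) => //.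
- by rewrite cons_uniq up andbT; apply/negP => /mp; rewrite ltnn.
- rewrite /= adjacent_sym euv rcons_path -lw ewv andbT.
  by apply: sub_path ep => x y /= /and3P[].
- by rewrite !inE eqxx orbT.
- by rewrite lw inE mem_last orbT.
Qed.

(** Earlier neighbours of [v] are pairwise adjacent, and those other than [t] precede [t].
    Conversely, let [x] be an earlier neighbour of [t]. So is [u], hence [x] and [u] are equal or
    adjacent; in the latter case the cycle v, t, x, u makes [x] a neighbour of [v]. This is where
    the second neighbour [u] enters. *)
Lemma earlier_neighbours v t u :
  e t v -> pos t < pos v -> e u v -> pos u < pos v -> u != t ->
  (forall x, e x v -> pos x < pos v -> pos x <= pos t) ->
  forall x, (e x v && (pos x < pos v)) = (x == t) || (e x t && (pos x < pos t)).
Proof.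
move=> etv tv euv uv ut maxt.
have below x : e x v -> pos x < pos v -> x != t -> e x t && (pos x < pos t).
  move=> exv xv xt; rewrite (earlier_adjacent exv etv) //= ltn_neqAle maxt // andbT.
  by apply: contra xt => /eqP/pos_inj->.
move=> x; have [->|xt] /= := eqVneq x t; first by rewrite etv tv.
apply/andP/andP => [[exv xv]|[ext ltxt]]; first by apply/andP; exact: below.
have xv : pos x < pos v by apply: ltn_trans ltxt tv.
split=> //; have [->//|xu] := eqVneq x u.
have /andP[eut ltut] := below _ euv uv ut.
have neq y z : pos y < pos z -> z != y by move=> h; apply: contraTneq h => ->; rewrite ltnn.
have exu := earlier_adjacent ext eut ltxt ltut xu.
apply: (block_graph_cycle (c := [:: v; t; x; u]) sG bG); rewrite ?inE ?eqxx ?orbT //; last by rewrite eq_sym neq.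
- by rewrite /= !inE !negb_or xu !neq.
- by rewrite /= ![e v _]adjacent_sym etv adjacent_sym ext exu euv.
Qed.

End SearchOrder.

(** * The dynamic program *)

(** Ties go to the later index and the empty range gives 0, to match the innermost loop of
    [fold_code] step by step. *)
Fixpoint amax (f : nat -> nat) (m : nat) : nat :=
  if m is m'.+1 then if f (amax f m') <= f m' then m' else amax f m' else 0.

Lemma amaxP f m : 0 < m -> amax f m < m /\ (forall j, j < m -> f j <= f (amax f m)).
Proof.
elim: m => [//|[|m] IH] _.
  by rewrite /= leqnn; split=> // j; rewrite ltnS leqn0 => /eqP->.
have [lt_m maxm] := IH isT; rewrite [amax f m.+2]/= -/(amax f m.+1).
case: (leqP (f (amax f m.+1))) => h; split=> //.
- by move=> j; rewrite ltnS leq_eqVlt => /predU1P[->//|/maxm] /leq_trans; apply.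
- exact: leqW.
- by move=> j; rewrite ltnS leq_eqVlt => /predU1P[->|/maxm //]; exact: ltnW.
Qed.

(** The additive form avoids truncated subtraction. *)
Lemma sum_except (f g : nat -> nat) m t : t < m ->
  (forall v, v < m -> v != t -> f v = g v) ->
  \sum_(v < m) f v + g t = \sum_(v < m) g v + f t.
Proof.
move=> tm fg; rewrite (bigD1 (Ordinal tm)) //= [in RHS](bigD1 (Ordinal tm)) //=.
rewrite (eq_bigr (fun v : 'I_m => g v)); first lia.
by move=> v; rewrite -val_eqE /= => vt; apply: fg.
Qed.

Lemma sum_recr (f : nat -> nat) m : \sum_(v < m.+1) f v = \sum_(v < m) f v + f m.
Proof. exact: big_ord_recr. Qed.

Section Dp.
Variables (n k : nat) (par cnt : nat -> nat) (loc : nat -> nat -> nat).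
Hypothesis n0 : 0 < n.
Hypothesis k0 : 0 < k.
Hypothesis par_lt : forall c, 0 < c < n -> par c < c.
Let K := k.+1.

(* A state q encodes a selection bit [q %% 2] together with the number
   [q %/ 2], capped at k, of earlier selected neighbours. *)
Definition ctx (c q : nat) : nat :=
  (cnt c == 1) * (q %% 2) + (1 < cnt c) * (q %/ 2 + q %% 2 - (q %/ 2 + q %% 2 - k)).

(** An index [q * K + j] pairs a state [q] with a share [j] of the cardinality. The maximum over the
    selection bit of [c] is written as u + (w - u) with truncated subtraction, since the machine has
    no maximum. *)
Definition better (T : nat -> nat -> nat) (c i j : nat) : nat :=
  T c (2 * i * K + j) + (T c (2 * i * K + K + j) - T c (2 * i * K + j)).

(** The child takes [j] out of the share of its parent. As [j] never exceeds [x %% K] in [choice],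
    the index [x - j] still has the state of [x]. *)
Definition gain T c x j := T (par c) (x - j) + better T c (ctx c (x %/ K)) j.

Definition choice T c x := amax (gain T c x) (x %% K).+1.

Definition fold T c v :=
  if v == par c then fun x => gain T c x (choice T c x) else T v.

Lemma fold_par T c x : fold T c (par c) x = gain T c x (choice T c x).
Proof. by rewrite /fold eqxx. Qed.

Lemma fold_other T c v : v != par c -> fold T c v = T v.
Proof. by rewrite /fold => /negPf->. Qed.

(* [table m] is the table when the vertices from m on have been folded into
   their parents. *)
Fixpoint table_rec l := if l is l'.+1 then fold (table_rec l') (n - l) else loc.
Definition table m := table_rec (n - m).

Lemma ctx_le c q : ctx c q <= k.
Proof.
clear n0 par_lt.
rewrite /ctx; move: (ltn_pmod q (isT : 0 < 2)).
by case: eqP => [->|_]; [|case: (1 < cnt c)] => /=; lia.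
Qed.

Lemma tableS m : m < n -> table m = fold (table m.+1) m.
Proof.
move=> mn; rewrite /table.
have e : n - (n - m.+1).+1 = m by lia.
have -> : n - m = (n - m.+1).+1 by lia.
by rewrite -[RHS]/(fold (table_rec _) m) -{3}e.
Qed.

Lemma table_n : table n = loc.
Proof. by rewrite /table subnn. Qed.

Lemma better_max T c i j : better T c i j = maxn (T c (2 * i * K + j)) (T c ((2 * i + 1) * K + j)).
Proof. by rewrite /better maxnE mulnDl mul1n. Qed.

(** Folding a vertex up to [v] writes to a row strictly below that vertex, so row [v] is final once
    all later vertices are folded. Backtracking can thus read the last table in place of the
    intermediate ones. *)
Lemma table_stable m v : 0 < m -> m <= v.+1 -> v < n -> table m v = table v.+1 v.
Proof.
move=> m0; move: {2}(v.+1 - m) (erefl (v.+1 - m)) => d.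
elim: d m m0 => [|d IH] m m0 dm mv vn; first by congr (table _ v); lia.
rewrite tableS; last lia.
rewrite -[RHS](IH m.+1); try lia.
by rewrite fold_other //; move: (@par_lt m); lia.
Qed.

Lemma modKD q j : j <= k -> (q * K + j) %% K = j.
Proof. by move=> jk; rewrite modnMDl modn_small. Qed.

Lemma divKD q j : j <= k -> (q * K + j) %/ K = q.
Proof. by move=> jk; rewrite divnMDl // divn_small ?addn0. Qed.

(** Only the counts are constrained, each by the state of the parent; the selection bits stay
    free. *)
Definition valid (q : nat -> nat) m :=
  q 0 %/ 2 = 0 /\ forall c, 0 < c < m -> q c %/ 2 = ctx c (q (par c)).

(** The maximum in a fold ranges over all splits of the merged share, the present one included, so
    the sum never drops. *)
Lemma table_upper (q J : nat -> nat) : valid q n -> \sum_(v < n) J v = k ->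
  forall m, 0 < m <= n -> exists2 J' : nat -> nat, \sum_(v < m) J' v = k &
    \sum_(v < n) loc v (q v * K + J v) <= \sum_(v < m) table m v (q v * K + J' v).
Proof.
move=> [_ vq] Jk m; move: {2}(n - m) (erefl (n - m)) => d.
elim: d m => [|d IH] m dm /andP[m0 mn].
  have -> : m = n by lia.
  by exists J => //; rewrite table_n.
have [||J1 J1k le1] := IH m.+1; try lia.
have mn' : m < n by lia.
have tm : par m < m by apply: par_lt; rewrite m0.
rewrite !sum_recr (sum_recr (fun v => table m.+1 v (q v * K + J1 v))) in J1k le1.
(* The share of the folded vertex passes to its parent, which keeps the total at k. *)
pose J2 v := if v == par m then J1 v + J1 m else J1 v.
have J2t : J2 (par m) = J1 (par m) + J1 m by rewrite /J2 eqxx.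
have E0 : \sum_(v < m) J2 v + J1 (par m) = \sum_(v < m) J1 v + J2 (par m).
  by apply: sum_except => // v _ vt; rewrite /J2 (negPf vt).
exists J2; first by lia.
apply: leq_trans le1 _.
pose f v := table m v (q v * K + J2 v); pose g v := table m.+1 v (q v * K + J1 v).
have E1 : \sum_(v < m) f v + g (par m) = \sum_(v < m) g v + f (par m).
  apply: sum_except => // v _ vt; rewrite /f /g tableS // fold_other //.
  by rewrite /J2 (negPf vt).
suff : g (par m) + g m <= f (par m) by rewrite -/(g m); move: E1; rewrite /f /g; lia.
rewrite /f /J2 eqxx tableS // fold_par.
have J1m : J1 (par m) + J1 m <= k.
  by rewrite -J1k leq_add2r (bigD1 (Ordinal tm)) //= leq_addr.
set x := q _ * K + _.
have xm : x %% K = J1 (par m) + J1 m by rewrite modKD.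
have [_ /(_ (J1 m))] := @amaxP (gain (table m.+1) m x) (x %% K).+1 isT.
rewrite -/(choice _ _ _) => max_m; apply: leq_trans (max_m _); last by rewrite xm; lia.
rewrite /gain /x divKD // -vq ?m0 // addnA addnK leq_add2l better_max /g.
rewrite {1}(divn_eq (q m) 2) [_ %/ 2 * 2]mulnC modn2 leq_max.
by case: (odd (q m)); rewrite ?addn0 leqnn ?orbT.
Qed.

Definition opt := better (table 1) 0 0 k.

Lemma opt_upper (q J : nat -> nat) : valid q n -> \sum_(v < n) J v = k ->
  \sum_(v < n) loc v (q v * K + J v) <= opt.
Proof.
move=> vq Jk; have [|J' J'k le1] := table_upper vq Jk (m := 1); first by rewrite n0.
apply: leq_trans le1 _; rewrite big_ord1; rewrite big_ord1 in J'k; rewrite /= J'k.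
rewrite /opt better_max (divn_eq (q 0) 2) vq.1 leq_max modn2.
by case: (odd (q 0)); rewrite ?leqnn ?orbT.
Qed.

(** The folds are undone in the opposite order: the recorded choice splits the share of the parent,
    and the bit of the new vertex is the one that attains the maximum in [better]. *)
Fixpoint backtrack m : (nat -> nat) * (nat -> nat) :=
  if m is m'.+1 then
    let: (q, J) := backtrack m' in
    let t := par m in
    let j := choice (table m.+1) m (q t * K + J t) in
    let i := ctx m (q t) in
    (upd q m (2 * i + (table 1 m (2 * i * K + j) < table 1 m (2 * i * K + K + j))),
     upd (upd J t (J t - j)) m j)
  else (fun=> nat_of_bool (table 1 0 k < table 1 0 (K + k)), fun=> k).

Lemma table_pick m i j :
  table 1 m ((2 * i + (table 1 m (2 * i * K + j) < table 1 m (2 * i * K + K + j))) * K + j)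
  = better (table 1) m i j.
Proof.
rewrite better_max [(_ + 1) * _]mulnDl mul1n; case: ltnP => h.
  by rewrite mulnDl mul1n.
by rewrite /= addn0.
Qed.

Lemma better_table1 m i j : m < n -> better (table 1) m i j = better (table m.+1) m i j.
Proof. by move=> mn; rewrite /better (@table_stable 1). Qed.

(** An undone fold replaces one entry by the two summands that attained it, so the sum equals [opt]
    at every stage, down to the local tables. *)
Lemma backtrackP m (q := (backtrack m).1) (J := (backtrack m).2) : m < n ->
  [/\ valid q m.+1, \sum_(v < m.+1) J v = k &
      \sum_(v < m.+1) table m.+1 v (q v * K + J v) = opt].
Proof.
elim: m @q @J => [|m IH] q J mn.
  rewrite /q /J !big_ord1 /=; split=> //.
    by split; [case: (_ < _) | move=> c; lia].
  rewrite /opt -(table_pick 0 0 k) !muln0 !mul0n !add0n; congr (table _ _ (_ * _ + _)).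
have [] := IH (ltnW mn); rewrite {}/q {}/J [backtrack m.+1]/=.
case: (backtrack m) => q J /= [q0 vq] Jk eopt.
set t := par m.+1; set i := ctx _ _; set j := choice _ _ _.
have tm : t < m.+1 by apply: par_lt.
have Jt : J t <= k by rewrite -Jk (bigD1 (Ordinal tm)) //= leq_addr.
have jJ : j <= J t.
  have [] := @amaxP (gain (table m.+2) m.+1 (q t * K + J t)) ((q t * K + J t) %% K).+1 isT.
  by rewrite -/(choice _ _ _) modKD.
set q' := upd q _ _; set J' := upd _ m.+1 _.
have q'v v : v < m.+1 -> q' v = q v.
  by move=> vm; rewrite /q' /upd ifN //; apply: contraTneq vm => ->; rewrite ltnn.
have J'v v : v < m.+1 -> J' v = if v == t then J t - j else J v.
  by move=> vm; rewrite /J' /upd ifN //; apply: contraTneq vm => ->; rewrite ltnn.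
have q'm : q' m.+1 = 2 * i + (table 1 m.+1 (2 * i * K + j) < table 1 m.+1 (2 * i * K + K + j)).
  by rewrite /q' /upd eqxx.
have J'm : J' m.+1 = j by rewrite /J' /upd eqxx.
split.
- split; first by rewrite q'v.
  move=> c /andP[c0]; rewrite ltnS leq_eqVlt => /predU1P[->|]; last first.
    move=> cm; rewrite q'v // q'v ?vq ?c0 //.
    apply: (ltn_trans _ cm); apply: par_lt; lia.
  rewrite q'm q'v // -/t -/i mulnC divnMDl //.
  by case: (_ < _); rewrite addn0.
- rewrite sum_recr J'm.
  have E : \sum_(v < m.+1) J' v + J t = \sum_(v < m.+1) J v + J' t.
    by apply: sum_except => // v vm vt; rewrite J'v // (negPf vt).
  by move: E; rewrite Jk J'v // eqxx; lia.
rewrite (sum_recr (fun v => table m.+2 v (q' v * K + J' v))) q'm J'm.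
have -> : table m.+2 m.+1 = table 1 m.+1 by rewrite (@table_stable 1).
rewrite table_pick better_table1 //.
pose f v := table m.+2 v (q' v * K + J' v); pose g v := table m.+1 v (q v * K + J v).
have E : \sum_(v < m.+1) f v + g t = \sum_(v < m.+1) g v + f t.
  apply: sum_except => // v vm vt; rewrite /f /g q'v // J'v // (negPf vt).
  by rewrite [table m.+1]tableS // fold_other.
have gt : g t = f t + better (table m.+2) m.+1 i j.
  rewrite /g tableS // fold_par /gain -/j divKD // -/i /f q'v // J'v // eqxx.
  by rewrite addnBA.
have {}eopt : \sum_(v < m.+1) g v = opt := eopt.
by rewrite -[\sum_(_ < _) _]/(\sum_(v < m.+1) f v); clearbody f g; lia.
Qed.

Lemma backtrack_opt (q := (backtrack n.-1).1) (J := (backtrack n.-1).2) :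
  [/\ valid q n, \sum_(v < n) J v = k & \sum_(v < n) loc v (q v * K + J v) = opt].
Proof. by have := @backtrackP n.-1; rewrite prednK // table_n; apply. Qed.

Lemma ctx_index c q i j b : i = ctx c q -> j <= k -> b <= 1 -> 2 * i * K + b * K + j < 2 * K * K.
Proof. by move=> -> jk b1; have := ctx_le c q; rewrite /K; nia. Qed.

(** A fold adds entries of two rows, so a uniform bound could double each time. Instead every row
    has its own bound, [M] for each vertex merged into it; the bounds of the remaining rows sum to
    at most [n * M]. *)
Lemma table_bound M : (forall v x, v < n -> x < 2 * K * K -> loc v x <= M) ->
  forall m v x, 0 < m <= n -> v < n -> x < 2 * K * K -> table m v x <= n * M.
Proof.
move=> locM.
suff tb d m : n - m = d -> 0 < m <= n -> exists2 u : nat -> nat, \sum_(v < m) u v <= n * M &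
   forall v x, v < n -> x < 2 * K * K -> table m v x <= u v <= n * M.
  move=> m v x mn vn xK; have [u _ ub] := tb _ m erefl mn.
  by have /andP[] := ub v x vn xK; apply: leq_trans.
elim: d m => [|d IH] m dm mn.
  have -> : m = n by lia.
  exists (fun=> M); first by rewrite sum_nat_const card_ord.
  by move=> v x vn xK; rewrite table_n locM // leq_pmull.
have [||u su ub] := IH m.+1; try lia.
have tm : par m < m by apply: par_lt; lia.
have mn' : m < n by lia.
pose u' v := if v == par m then u v + u m else u v.
rewrite sum_recr in su.
have ut : u' (par m) = u (par m) + u m by rewrite /u' eqxx.
have E : \sum_(v < m) u' v + u (par m) = \sum_(v < m) u v + u' (par m).
  by apply: sum_except => // v _ vt; rewrite /u' (negPf vt).
have su' : \sum_(v < m) u' v <= n * M by lia.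
exists u' => // v x vn xK; rewrite tableS // /u'; have [->|vt] := eqVneq v (par m); last by rewrite fold_other //; exact: ub.
rewrite fold_par; apply/andP; split.
  rewrite /gain; apply: leq_add.
    have xj : x - choice (table m.+1) m x < 2 * K * K by apply: leq_ltn_trans xK; exact: leq_subr.
    by have /andP[] := ub (par m) _ (ltn_trans tm mn') xj.
  have ubm y : y < 2 * K * K -> table m.+1 m y <= u m by move=> yK; case/andP: (ub m y mn' yK).
  set j := choice _ _ _; have jk : j <= k.
    have [+ _] := @amaxP (gain (table m.+1) m x) (x %% K).+1 isT.
    by rewrite -/(choice _ _ _) -/j; move: (ltn_pmod x (ltn0Sn k)); rewrite -/K /K; lia.
  have i0 := ctx_index erefl jk (leq0n 1) (c := m) (q := x %/ K).
  have i1 := ctx_index erefl jk (leqnn 1) (c := m) (q := x %/ K).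
  rewrite mul0n addn0 in i0; rewrite mul1n in i1.
  by rewrite better_max geq_max !ubm // mulnDl mul1n.
by apply: leq_trans su'; rewrite (bigD1 (Ordinal tm)) //= ut leq_addr.
Qed.

End Dp.

(** * Optimal selections with a prescribed trace on the deletion set *)

Lemma half2D (i : nat) (c : bool) : (2 * i + c) %/ 2 = i.
Proof. by rewrite mulnC divnMDl //; case: c; rewrite addn0. Qed.

Lemma mod2D (i : nat) (c : bool) : (2 * i + c) %% 2 = c.
Proof. by rewrite mulnC modnMDl; case: c. Qed.

Lemma bigmax_mem (r : seq nat) (P : pred nat) : has P r ->
  (\max_(q <- r | P q) q \in r) && P (\max_(q <- r | P q) q).
Proof.
elim: r => //= x r IH; rewrite big_cons inE.
case Px: (P x) => /=; last by move=> /IH /andP[-> ->]; rewrite orbT.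
case hr: (has P r).
  case/andP: (IH hr) => mr Pm _; set m := \max_(_ <- _ | _) _ in mr Pm *.
  by case: (leqP x m) => _; rewrite ?eqxx ?mr ?orbT ?Px ?Pm.
move=> _; rewrite big_hasC ?hr // maxn0 eqxx Px //.
Qed.

Section Spec.
Variables (n k d : nat) (na : nat -> seq nat) (dense : bool).
Hypothesis k0 : 0 < k.
Hypothesis kn : k <= n.
Hypothesis dn : d <= n.
Hypothesis na_uniq : forall p, p < n -> uniq (na p).
Hypothesis na_lt : forall p q, p < n -> q \in na p -> q < n.

Let M := 4 * n * n.
Let K := k.+1.

Definition earlier p := [pred q | d <= q < p].
(** The empty maximum is 0: vertices of the deletion set and first vertices of components become
    children of position 0. There [cnt] is 0, which makes their context 0. *)
Definition par p := \max_(q <- na p | earlier p q) q.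
Definition cnt p := count (earlier p) (na p).
Definition fixed_weight (xs : nat -> nat) p := \sum_(q <- na p | (q < p) && (q < d)) xs q.
(** The offset n keeps the sparse variant nonnegative; over k selected vertices it adds up to the
    constant [k * n]. *)
Definition signed v := binop_val (if dense then OpAdd else OpSub) n v.

(* The bonus M makes every table entry with the wrong cardinality, or a
   selection inside the deletion set different from xs, irrelevant. *)
Definition local xs p x :=
  (x %% K == x %/ K %% 2) * (1 - (p < d) * (1 - (xs p == x %/ K %% 2))) *
  (M + x %/ K %% 2 * signed (fixed_weight xs p + x %/ K %/ 2)).

Lemma par_lt c : 0 < c < n -> par c < c.
Proof.
move=> /andP[c0 _]; rewrite /par; elim/big_ind: _ => // [x y|q /andP[]] //.
by rewrite gtn_max => -> ->.
Qed.

Hypothesis structure : forall p q, p < n -> 1 < cnt p ->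
  (q \in na p) && earlier p q = (q == par p) || (q \in na (par p)) && earlier (par p) q.

Lemma par_earlier p : p < n -> 0 < cnt p -> (par p \in na p) && earlier p (par p).
Proof.
by rewrite /cnt -has_count => _ /bigmax_mem.
Qed.

Section Selection.
Variable b : nat -> bool.

Definition selected p := count (fun q => earlier p q && b q) (na p).
Definition degree p := count (fun q => (q < p) && b q) (na p).

(** [cnt] distinguishes the three shapes of the set of earlier neighbours. In the last one it is the
    parent together with the set of the parent, and capping at k before and after adding the bit of
    the parent is the same as capping once. *)
Lemma selected_ctx c : 0 < c < n ->
  minn k (selected c) = ctx k cnt c (2 * minn k (selected (par c)) + b (par c)).
Proof.
move=> c0n; have [cn pc] : c < n /\ par c < c by split; [lia | exact: par_lt].
have selE p : selected p = count b (filter (earlier p) (na p)).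
  by rewrite count_filter; apply: eq_count => q /=; rewrite andbC.
rewrite /ctx mod2D half2D; have := par_earlier cn; have := @structure c.
rewrite /cnt -size_filter selE.
have mem_f q : (q \in na c) && earlier c q = (q \in filter (earlier c) (na c)).
  by rewrite mem_filter andbC.
rewrite mem_f; set A := filter _ _ in mem_f * => str parA.
case sA: (size A) => [|[|m]]; rewrite /= ?mul1n ?mul0n ?add0n ?addn0.
- by rewrite (size0nil sA) minn0.
- case: A sA parA {mem_f str} => [//|x [|//]] _ /(_ isT); rewrite inE => /eqP->.
  by rewrite /= !addn0; apply/minn_idPr; case: (b x).
have perm_A : perm_eq A (par c :: filter (earlier (par c)) (na (par c))).
  apply: uniq_perm; first exact/filter_uniq/na_uniq.
    by rewrite cons_uniq mem_filter /= ltnn !andbF filter_uniq ?na_uniq ?(ltn_trans pc).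
  by move=> q; rewrite -mem_f str ?sA // in_cons mem_filter [_ && (_ \in _)]andbC. 
rewrite (permP perm_A) /= -selE !minnE; case: (b _) => /=; lia.
Qed.

Lemma sum_count : \sum_(v < n) b v = count b (iota 0 n).
Proof.
rewrite -(big_mkord xpredT (fun v => nat_of_bool (b v))) /index_iota subn0.
by rewrite -sum1_count [RHS]big_mkcond; apply: eq_bigr => v _; case: (b v).
Qed.

Lemma count_le_sum p : p < n -> count b (na p) <= \sum_(v < n) b v.
Proof.
move=> pn; rewrite sum_count.
apply: leq_trans (_ : count b (filter (fun q => q < n) (na p)) <= _).
  rewrite (eq_in_filter (a2 := predT)) ?filter_predT // => q /(na_lt pn) -> //.
rewrite -!size_filter; apply: uniq_leq_size; first by rewrite !filter_uniq ?na_uniq.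
by move=> q; rewrite !mem_filter mem_iota => /andP[-> /andP[->]].
Qed.

Hypothesis sum_b : \sum_(v < n) b v = k.

(** Hence the cap, which limits the number of states, does not distort a selection of k vertices. *)
Lemma selected_le p : p < n -> selected p <= k.
Proof.
move=> pn; rewrite -sum_b; apply: leq_trans (count_le_sum pn).
by apply: sub_count => q /andP[].
Qed.

Lemma degreeE (xs : nat -> nat) p : (forall q, q < d -> xs q = b q) ->
  fixed_weight xs p + selected p = degree p.
Proof.
move=> xb; rewrite /fixed_weight /selected /degree.
elim: (na p) => [|q r IH] /=; first by rewrite big_nil.
rewrite big_cons -{}IH; case: (ltnP q d) => qd; rewrite ?andbT ?andbF /=.
  by rewrite xb //; case: (q < p) => /=; rewrite ?add0n ?addnA ?addn0.
by case: (q < p) => /=; lia.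
Qed.

Lemma local_consistent (xs : nat -> nat) (q p J : nat) : p < n -> q %% 2 = b p -> q %/ 2 = minn k (selected p) ->
  J = b p -> (forall q, q < d -> xs q = b q) ->
  local xs p (q * K + J) = M + b p * signed (degree p).
Proof.
move=> pn q2 qh -> xb; have bk : b p <= k by case: (b p).
rewrite /local modKD // divKD // q2 qh eqxx (minn_idPr (selected_le pn)) (degreeE _ xb) mul1n.
case: (ltnP p d) => pd; last by rewrite mul0n subn0 mul1n.
by rewrite xb // eqxx subnn muln0 subn0 mul1n.
Qed.

Lemma opt_lower (xs : nat -> nat) : (forall q, q < d -> xs q = b q) ->
  n * M + \sum_(p < n) b p * signed (degree p) <= opt n k par cnt (local xs).
Proof.
move=> xb.
have n0 : 0 < n by apply: leq_trans kn.
have vq : valid k par cnt (fun p => 2 * minn k (selected p) + b p) n.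
  split=> [|c cn].
    rewrite half2D.
    rewrite /selected (eq_count (a2 := pred0)) ?count_pred0 ?minn0 // => q /=.
    by rewrite ltn0 !andbF.
  rewrite half2D.
  exact: selected_ctx.
apply: (leq_trans _ (opt_upper (local xs) n0 k0 par_lt (J := fun v => nat_of_bool (b v)) vq sum_b)).
rewrite -[n in n * M](card_ord n) -sum_nat_const -big_split /=.
apply: leq_sum => p _; rewrite (local_consistent (ltn_ord p)) ?mod2D ?half2D //.
Qed.

End Selection.

Lemma size_na p : p < n -> size (na p) <= n.
Proof.
move=> pn; rewrite -[n in _ <= n](size_iota 0); apply: uniq_leq_size; first exact: na_uniq.
by move=> q /(na_lt pn); rewrite mem_iota.
Qed.

Lemma fixed_weight_le (xs : nat -> nat) p : (forall p, xs p <= 1) -> p < n ->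
  fixed_weight xs p <= n.
Proof.
move=> xs1 pn; apply: leq_trans (size_na pn); rewrite /fixed_weight -sum1_size.
by rewrite big_mkcond; apply: leq_sum => q _; case: ifP.
Qed.

Lemma signed_le v : signed v <= n + v.
Proof. by rewrite /signed; case: dense => //=; lia. Qed.

(** The term [3 * n] consists of the offset of [signed], a fixed weight of at most n and a count of
    at most k <= n. *)
Lemma local_le (xs : nat -> nat) p x : (forall p, xs p <= 1) -> p < n -> x < 2 * K * K ->
  local xs p x <= M + 3 * n.
Proof.
move=> xs1 pn xK; rewrite /local.
have i_le : x %/ K %/ 2 <= k.
  by rewrite -divnMA -ltnS ltn_divLR ?muln_gt0 // [K * 2]mulnC mulnC -/K; lia.
have w_le := fixed_weight_le xs1 pn.
have v_le := signed_le (fixed_weight xs p + x %/ K %/ 2).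
have r_le : x %/ K %% 2 <= 1 by rewrite modn2; case: odd.
apply: (@leq_trans (1 * (M + 1 * (3 * n)))); last by rewrite !mul1n.
apply: leq_mul; first by case: (_ == _); rewrite ?mul0n ?mul1n ?leq_subr.
rewrite leq_add2l leq_mul //; lia.
Qed.

Lemma opt_solution (xs : nat -> nat) (q := (backtrack n k par cnt (local xs) n.-1).1) (b := fun p => odd (q p)) :
  (forall p, xs p <= 1) -> n * M <= opt n k par cnt (local xs) ->
  [/\ \sum_(p < n) b p = k, forall p, p < d -> xs p = b p &
      opt n k par cnt (local xs) = n * M + \sum_(p < n) b p * signed (degree b p)].
Proof.
move=> xs1 ge_opt.
have n0 : 0 < n by apply: leq_trans kn.
have [] := @backtrack_opt n k par cnt (local xs) n0 k0 par_lt.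
rewrite -/q; set J := (backtrack _ _ _ _ _ _).2 => vq Jk eopt.
pose f p := local xs p (q p * K + J p).
have fM p : p < n -> f p <= M + 3 * n.
  move=> pn; apply: local_le => //.
  have Jp : J p <= k by rewrite -Jk (bigD1 (Ordinal pn)) //= leq_addr.
  have : q p %/ 2 <= k.
    have [->|p0] := posnP p; first by rewrite vq.1.
    by rewrite vq.2 ?p0 //; exact: ctx_le.
  move: (ltn_pmod (q p) (isT : 0 < 2)) (divn_eq (q p) 2); rewrite /K; nia.
have f0 p : p < n -> 0 < f p.
  move=> pn; rewrite lt0n; apply/eqP => fp0.
  (* With one vanishing entry the sum is at most (n - 1)(M + 3n), which is below [n * M] because M =
     4n^2. So no entry vanishes: the shares are the selection bits, and these agree with [xs] on the
     deletion set. *)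
  have : \sum_(v < n) f v <= n.-1 * (M + 3 * n).
    rewrite (bigD1 (Ordinal pn)) //= fp0 add0n.
    apply: leq_trans (_ : \sum_(v < n | v != Ordinal pn) (M + 3 * n) <= _).
      by apply: leq_sum => v _; exact: fM.
    by rewrite sum_nat_const cardC1 card_ord.
  have ef : \sum_(v < n) f v = opt n k par cnt (local xs) by exact: eopt.
  by rewrite ef; move: ge_opt; rewrite /M; nia.
have Jle p : p < n -> J p <= k.
  by move=> pn; rewrite -Jk (bigD1 (Ordinal pn)) //= leq_addr.
have q2 p : q p %% 2 = b p by rewrite modn2.
have cons p : p < n -> J p = b p /\ (p < d -> xs p = b p).
  move=> pn; have := f0 p pn; rewrite /f /local modKD ?Jle // divKD ?Jle // q2.
  rewrite !muln_gt0; case: eqP => //= Jb /andP[+ _]; rewrite lt0n => h.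
  by split=> // pd; move: h; rewrite pd mul1n; case: (xs p =P b p).
have sum_b : \sum_(p < n) b p = k.
  by rewrite -Jk; apply: eq_bigr => p _; have [->] := cons p (ltn_ord p).
have xb p : p < d -> xs p = b p.
  by move=> pd; have [|_ ->] := cons p; rewrite // (leq_trans pd).
(* The selection bits determine a valid state: induction along parents repeats the recurrence of
   [selected_ctx]. *)
have qh p : p < n -> q p %/ 2 = minn k (selected b p).
  elim/ltn_ind: p => p IH pn.
  have [->|p0] := posnP p.
    rewrite vq.1 /selected (eq_count (a2 := pred0)) ?count_pred0 ?minn0 // => v /=.
    by rewrite ltn0 !andbF.
  have tp : par p < p by apply: par_lt; rewrite p0.
  rewrite vq.2 ?p0 // selected_ctx ?p0 // -(IH _ tp (ltn_trans tp pn)).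
  by rewrite -q2 mulnC -divn_eq.
split=> //; rewrite -[n in n * M](card_ord n) -sum_nat_const -big_split /= -eopt.
apply: eq_bigr => p _; apply: local_consistent => //; first exact: qh.
by have [->] := cons p (ltn_ord p).
Qed.

Lemma degree_le b p : p < n -> degree b p <= n.
Proof. by move=> pn; apply: leq_trans (size_na pn); exact: count_size. Qed.

(** No truncation occurs in the sparse case, since each [degree] is at most n. *)
Lemma sum_signed (b : nat -> bool) : \sum_(p < n) b p = k ->
  \sum_(p < n) b p * signed (degree b p) =
  binop_val (if dense then OpAdd else OpSub) (k * n) (\sum_(p < n) b p * degree b p).
Proof.
move=> <-; rewrite big_distrl /= /signed; case: dense => /=.
  by rewrite -big_split /=; apply: eq_bigr => p _; rewrite mulnDr.
rewrite -sumnB => [|p _]; first by apply: eq_bigr => p _; rewrite mulnBr.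
by rewrite leq_mul2l degree_le ?orbT.
Qed.

(** In the sparse case this lets the comparison of two edge counts be recovered from their truncated
    differences to [k * n]. *)
Lemma sum_degree_le (b : nat -> bool) : \sum_(p < n) b p = k -> \sum_(p < n) b p * degree b p <= k * n.
Proof.
move=> <-; rewrite big_distrl /=; apply: leq_sum => p _.
by rewrite leq_mul2l degree_le ?orbT.
Qed.

End Spec.

(** * The program *)

Arguments upd _ _ _ _ _ /.

Lemma wp_for_le B (x : nat) lo hi p s N b (I : nat -> store -> Prop) (Q : nat -> store -> Prop) :
  x \notin mod_regs p -> pval s lo <= N -> N < B ->
  I (pval s lo) (set_reg s x (pval s lo)) ->
  (forall l s', pval s lo <= l <= N -> I l s' -> reg s' x = l ->
     frame (For x lo hi p) s s' -> pval s' hi = N) ->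
  (forall l s', pval s lo <= l < N -> I l s' -> reg s' x = l ->
     frame (For x lo hi p) s s' ->
     wp B p s' (fun t s2 => t <= b /\ I l.+1 (set_reg s2 x l.+1))) ->
  (forall t s', t <= (N - pval s lo) * (b + cost hi + 7) + cost lo + cost hi + 4 ->
     I N s' -> reg s' x = N -> frame (For x lo hi p) s s' -> Q t s') ->
  wp B (For x lo hi p) s Q.
Proof.
move=> xp lN NB I0 hhi hp hQ; set c := b + cost hi + 7 in hQ.
apply: (@wp_for _ _ _ _ _ _ N (fun l T s' => T <= (l - pval s lo) * c /\ I l s')) => //.
- by move=> l T s' ll [_ Il]; apply: hhi Il.
- move=> l T s' ll [Tl Il] rx fr; apply: wp_conseq (hp _ _ ll Il rx fr) _ => t s2 _ [tb I2].
  by split=> //; rewrite subSn ?mulSn; [rewrite /c; lia | case/andP: ll].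
- by move=> T s' [TN IN] rx fr; apply: hQ IN rx fr; lia.
Qed.

Notation "x +' y" := (Bin OpAdd x y) (at level 50, left associativity).
Notation "x -' y" := (Bin OpSub x y) (at level 50, left associativity).
Notation "x *' y" := (Bin OpMul x y) (at level 40, left associativity).
Notation "x /' y" := (Bin OpDiv x y) (at level 40, left associativity).
Notation "x %' y" := (Bin OpMod x y) (at level 40, left associativity).
Notation "x =' y" := (Bin OpEq x y) (at level 70).
Notation "x <' y" := (Bin OpLt x y) (at level 70).
Notation "x ::= e" := (Assign x e) (at level 85).
Notation "p ;; q" := (Seq p q) (at level 90, right associativity).

Coercion Reg : nat >-> expr.

(* A bare number used as an expression is a register; literals are under [Lit].
   Registers: 0, ..., 5 hold n, k, d, K = k + 1, 2 K^2 and M = 4 n^2; 11 is set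
   when all subsets of the deletion set are done; 12 holds the best value.
   Arrays: 3 maps positions to vertices and 4 is its inverse; 5 is the current
   subset of the deletion set; 6, 7, 8 hold [fixed_weight], [par] and [cnt];
   9 and 10 hold [table] and [choice]; 11 and 12 hold the result of
   [backtrack]. *)
Definition swap_code : prog :=
  13 ::= Get 4 10;; 14 ::= Get 3 7;;
  Put 3 13 14;; Put 4 14 13;; Put 3 7 10;; Put 4 10 7.

Definition scan_code (r : nat) (p : prog) : prog :=
  For 9 (Get 0 r) (Get 0 (r +' Lit 1)) (10 ::= Get 1 9;; p).

Definition identity_code : prog := For 6 (Lit 0) 0 (Put 3 6 6;; Put 4 6 6).

Definition deletion_set_code : prog := For 7 (Lit 0) 2 (10 ::= Get 2 7;; swap_code).

(** The vertex order itself is the queue, with head in register 6 and tail in register 7; a vertex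
    is discovered by swapping it to the tail. Register 7 arrives from [deletion_set_code] with the
    value d, so the deletion set counts as discovered. A head that meets the tail opens a
    component. *)
Definition search_code : prog :=
  For 6 2 0
    (If (7 =' 6) (7 ::= 7 +' Lit 1) Skip;;
     8 ::= Get 3 6;;
     scan_code 8 (If (Get 4 10 <' 7) Skip (swap_code;; 7 ::= 7 +' Lit 1))).

(** Parents and counts do not depend on the trace, but recomputing them stays within the O(n + m)
    that the weights cost anyway. *)
Definition neighbours_code : prog :=
  For 6 (Lit 0) 0
    (13 ::= Get 4 6;; 14 ::= Lit 0;; 15 ::= Lit 0;; 16 ::= Lit 0;;
     scan_code 6
       (17 ::= Get 4 10;;
        If (17 <' 13)
          (If (17 <' 2) (14 ::= 14 +' Get 5 17)
             (16 ::= 16 +' Lit 1;; If (15 <' 17) (15 ::= 17) Skip))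
          Skip);;
     Put 6 13 14;; Put 7 13 15;; Put 8 13 16).

Definition local_code (dense : bool) : prog :=
  For 6 (Lit 0) (0 *' 4)
    (7 ::= 6 /' 4;; 8 ::= 6 %' 4;; 10 ::= 8 /' 3;;
     Put 9 6
       ((8 %' 3 =' 10 %' Lit 2) *' (Lit 1 -' (7 <' 2) *' (Lit 1 -' (Get 5 7 =' 10 %' Lit 2))) *'
        (5 +' 10 %' Lit 2 *' Bin (if dense then OpAdd else OpSub) 0 (Get 6 7 +' 10 /' Lit 2)))).

Definition ctx_expr (c q : expr) : expr :=
  (c =' Lit 1) *' (q %' Lit 2) +'
  (Lit 1 <' c) *' (q /' Lit 2 +' q %' Lit 2 -' (q /' Lit 2 +' q %' Lit 2 -' 1)).

Definition gain_expr (j : nat) : expr :=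
  Get 9 (14 -' j) +' (Get 9 (15 +' j) +' (Get 9 (16 +' j) -' Get 9 (15 +' j))).

(** The row of the parent is overwritten in place. Its new entry at [x] depends on old entries of
    that row at [x - j] only, which is why the index descends. *)
Definition fold_code : prog :=
  For 6 (Lit 1) 0
    (7 ::= 0 -' 6;; 8 ::= Get 7 7;;
     For 9 (Lit 0) 4
       (10 ::= 4 -' Lit 1 -' 9;;
        13 ::= 10 /' 3;; 13 ::= ctx_expr (Get 8 7) 13;;
        14 ::= 8 *' 4 +' 10;; 15 ::= 7 *' 4 +' Lit 2 *' 13 *' 3;; 16 ::= 15 +' 3;;
        17 ::= Lit 0;;
        For 18 (Lit 0) (10 %' 3 +' Lit 1)
          (If (gain_expr 18 <' gain_expr 17) Skip (17 ::= 18));;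
        Put 9 14 (gain_expr 17);; Put 10 (7 *' 4 +' 10) 17)).

Definition backtrack_code : prog :=
  Put 11 (Lit 0) (Get 9 1 <' Get 9 (3 +' 1));; Put 12 (Lit 0) 1;;
  For 6 (Lit 1) 0
    (8 ::= Get 7 6;; 10 ::= Get 11 8;; 13 ::= ctx_expr (Get 8 6) 10;;
     14 ::= 6 *' 4;; 15 ::= 14 +' Lit 2 *' 13 *' 3;;
     16 ::= Get 10 (14 +' (10 *' 3 +' Get 12 8));;
     Put 12 8 (Get 12 8 -' 16);; Put 12 6 16;;
     Put 11 6 (Lit 2 *' 13 +' (Get 9 (15 +' 16) <' Get 9 (15 +' 3 +' 16)))).

(** A binary counter with its carry in register 13; the carry out of the last bit ends the main
    loop. *)
Definition next_subset_code : prog :=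
  13 ::= Lit 1;;
  For 6 (Lit 0) 2
    (14 ::= Get 5 6 +' 13;; Put 5 6 (14 %' Lit 2);; 13 ::= 14 /' Lit 2);;
  11 ::= 13.

Definition subset_code (dense : bool) : prog :=
  neighbours_code;; local_code dense;; fold_code;;
  13 ::= Get 9 1 +' (Get 9 (3 +' 1) -' Get 9 1);;
  If (12 <' 13) (12 ::= 13;; backtrack_code) Skip;;
  next_subset_code.

Definition output_code : prog :=
  7 ::= Lit 0;;
  For 6 (Lit 0) 0 (If (Get 11 6 %' Lit 2) (Put 0 7 (Get 3 6);; 7 ::= 7 +' Lit 1) Skip);;
  0 ::= Lit 1.

Definition solver (dense : bool) : prog :=
  If (1 =' Lit 0) (0 ::= Lit 1)
    (If (0 <' 1) (0 ::= Lit 0)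
       (3 ::= 1 +' Lit 1;; 4 ::= Lit 2 *' 3 *' 3;; 5 ::= Lit 4 *' 0 *' 0;;
        identity_code;; deletion_set_code;; search_code;;
        While (11 =' Lit 0) (subset_code dense);;
        output_code)).

(** The cost bound 60 becomes the exponent of the polynomial bound on the word size. *)
Lemma solver_small dense : small_exprs 10 60 (solver dense).
Proof. by case: dense; vm_compute. Qed.

(** * Verification of the program *)

Definition offset (nb : nat -> seq nat) v := \sum_(u < v) size (nb u).

Lemma offsetS nb v : offset nb v.+1 = offset nb v + size (nb v).
Proof. exact: big_ord_recr. Qed.

Lemma offset_mono nb v w : v <= w -> offset nb v <= offset nb w.
Proof. by move/subnKC <-; elim: (w - v) => [|m IH]; rewrite ?addn0 ?addnS ?offsetS; lia. Qed.

Definition inverse_on n (o po : nat -> nat) :=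
  (forall p, p < n -> o p < n /\ po (o p) = p) /\
  (forall v, v < n -> po v < n /\ o (po v) = v).

Definition swap_ord (o po : nat -> nat) u t := upd (upd o (po u) (o t)) t u.
Definition swap_pos (o po : nat -> nat) u t := upd (upd po (o t) (po u)) u t.

Lemma swap_inverse n o po u t : inverse_on n o po -> u < n -> t < n ->
  inverse_on n (swap_ord o po u t) (swap_pos o po u t).
Proof.
move=> [io ip] un tn; rewrite /swap_ord /swap_pos; split=> [p pn|v vn] /=.
  case: (eqVneq p t) => [->|pt]; first by rewrite eqxx.
  case: (eqVneq p (po u)) => [->|pu].
    have [? e] := io t tn; split=> //; case: eqP => [eu|_]; last by rewrite eqxx.
    by rewrite -eu e.
  have [? e] := io p pn; split=> //.
  case: eqP => [eu|_]; first by rewrite -eu e eqxx in pu.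
  by case: eqP => // et; move: pt; rewrite -e et (io t tn).2 eqxx.
case: (eqVneq v u) => [->|vu]; first by rewrite eqxx.
case: (eqVneq v (o t)) => [->|vt].
  have [? e] := ip u un; split=> //; case: eqP => [eu|_]; last by rewrite eqxx.
  by rewrite -eu e.
have [? e] := ip v vn; split=> //.
case: eqP => [eu|_]; first by rewrite -eu e eqxx in vt.
by case: eqP => // et; move: vu; rewrite -e et (ip u un).2 eqxx.
Qed.

Lemma index_inj m v w x y : x < m -> y < m -> (v * m + x == w * m + y) = (v == w) && (x == y).
Proof.
move=> xm ym; apply/eqP/andP => [e|[/eqP-> /eqP->]//].
have m0 : 0 < m by apply: leq_ltn_trans xm.
have := congr1 (divn^~ m) e; have := congr1 (modn^~ m) e.
by rewrite !modnMDl !divnMDl // !modn_small // !divn_small // !addn0 => -> ->.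
Qed.

Lemma nat_of_bool_neq0 (b : bool) : (b : nat) != 0 -> b.
Proof. by case: b. Qed.

Lemma nat_of_bool_eq0 (b : bool) : (b : nat) = 0 -> b = false.
Proof. by case: b. Qed.

Section Verify.
Variables (n k d B : nat) (nb : nat -> seq nat) (ds : seq nat) (dense : bool).
Hypothesis k0 : 0 < k.
Hypothesis kn : k <= n.
Hypothesis nb_uniq : forall v, v < n -> uniq (nb v).
Hypothesis nb_lt : forall v u, v < n -> u \in nb v -> u < n.
Hypothesis ds_uniq : uniq ds.
Hypothesis ds_lt : forall u, u \in ds -> u < n.
Hypothesis size_ds : size ds = d.
Let K := k.+1.
Let QK := 2 * K * K.
Let M := 4 * n * n.
(** Table entries, at most [n * (M + 3 * n)], and table addresses, below [n * QK], are both cubic in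
    n. *)
Hypothesis B_big : 20 * n.+1 * n.+1 * n.+1 < B.

Lemma table_value_lt : 3 * (n * (M + 3 * n)) < B.
Proof.
apply: leq_ltn_trans B_big; rewrite /M; clear.
have : 0 <= n * n * n by []. have : 0 <= n * n by [].
by rewrite !mulnDr; lia.
Qed.

Lemma table_size : n * QK <= 2 * (n * n.+1 * n.+1).
Proof.
have Kn : K <= n.+1 by rewrite ltnS.
by rewrite /QK -mulnA mulnCA -[n * n.+1 * _]mulnA !leq_mul2l leq_mul ?orbT.
Qed.

Lemma table_size_lt : 4 * (n * QK) + 4 * QK + 4 * n + 20 < B.
Proof.
have n0 : 0 < n by apply: leq_trans kn.
apply: leq_ltn_trans (_ : 8 * (n * QK) + 4 * n + 20 < B).
  by have : QK <= n * QK; [exact: leq_pmull | lia].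
apply: leq_ltn_trans B_big; have := table_size; rewrite -!mulnA.
have e : n.+1 * (n.+1 * n.+1) = n * (n.+1 * n.+1) + n.+1 * n.+1 by rewrite mulSn addnC.
have e' : 2 * n.+1 <= n.+1 * n.+1 by rewrite leq_mul2r.
by rewrite {}e; move: (n * (n.+1 * n.+1)) (n.+1 * n.+1) e' => a b; lia.
Qed.

Lemma size_nb v : v < n -> size (nb v) <= n.
Proof.
move=> vn; rewrite -[n in _ <= n](size_iota 0); apply: uniq_leq_size; first exact: nb_uniq.
by move=> q /(nb_lt vn); rewrite mem_iota.
Qed.

Lemma offset_le v : v <= n -> offset nb v <= n * n.
Proof.
move=> vn; apply: leq_trans (offset_mono nb vn) _.
rewrite -[n in n * _](card_ord n) -sum_nat_const.
by apply: leq_sum => u _; exact: size_nb.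
Qed.

Lemma dn : d <= n.
Proof.
rewrite -size_ds -[n in _ <= n](size_iota 0); apply: uniq_leq_size => //.
by move=> u /ds_lt; rewrite mem_iota.
Qed.

Definition env s : Prop :=
  [/\ reg s 0 = n, reg s 1 = k, reg s 2 = d, reg s 3 = K & reg s 4 = QK] /\
  [/\ reg s 5 = M, forall v, v <= n -> arr s 0 v = offset nb v &
      forall v l, v < n -> l < size (nb v) -> arr s 1 (offset nb v + l) = nth 0 (nb v) l].

(** A boolean decided by computation, so that [env] is carried across a concrete program fragment
    without proof. *)
Definition keeps_env (p : prog) : bool :=
  all (fun x => x \notin mod_regs p) (iota 0 6) &&
  all (fun a => a \notin mod_arrs p) (iota 0 2).

Lemma env_frame p s s' : keeps_env p -> frame p s s' -> env s -> env s'.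
Proof.
case/andP=> /allP kr /allP ka [fr fa] [[e0 e1 e2 e3 e4] [e5 o0 o1]].
have r x : x \in iota 0 6 -> reg s' x = reg s x by move=> /kr; exact: fr.
have a x : x \in iota 0 2 -> arr s' x = arr s x by move=> /ka; exact: fa.
split; split; rewrite ?r //; [move=> v vn | move=> v l vn ln]; rewrite a //.
  exact: o0.
exact: o1.
Qed.

(** The overhead of 14 per neighbour is 3 for fetching it and 11 for the loop. The invariant counts
    list positions whereas register 9 holds memory addresses, so it must hold for any value of that
    register. *)
Lemma wp_scan (r : nat) p s v (I : nat -> nat -> store -> Prop) (Q : nat -> store -> Prop) :
  r \notin [:: 9, 10 & mod_regs p] -> 9 \notin mod_regs p -> keeps_env p ->
  v < n -> env s -> reg s r = v ->
  (forall x, I 0 0 (set_reg s 9 x)) ->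
  (forall l T s', l < size (nb v) -> I l T s' -> frame (scan_code r p) s s' ->
     wp B p (set_reg s' 10 (nth 0 (nb v) l))
       (fun t s2 => forall x, I l.+1 (T + t + 14) (set_reg s2 9 x))) ->
  (forall T s', I (size (nb v)) T s' -> frame (scan_code r p) s s' -> Q (T + 10) s') ->
  wp B (scan_code r p) s Q.
Proof.
rewrite !inE !negb_or => /and3P[r9 r10 rp] p9 kp vn en rv I0 hp hQ.
have [[_ _ _ _ _] [_ o0 o1]] := en.
have lo : pval s (Get 0 r) = offset nb v by rewrite /= rv o0 // ltnW.
have kenv : keeps_env (scan_code r p).
  case/andP: kp => /allP kr /allP ka; apply/andP; split; apply/allP => x xi /=.
    rewrite !inE mem_cat !inE (negPf (kr _ xi)) /=.
    by move: xi; rewrite mem_iota; case: x => [|[|[|[|[|[|]]]]]].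
  by rewrite cats0; exact: ka.
have fr_r s' : frame (scan_code r p) s s' -> reg s' r = v.
  by case=> + _ => ->; rewrite //= !inE mem_cat !inE !negb_or r9 r10 rp.
have size_off : offset nb v + size (nb v) = offset nb v.+1 by rewrite offsetS.
have offS := offset_le vn; have off0 := offset_le (ltnW vn).
apply: (@wp_for _ _ _ _ _ _ (offset nb v.+1)
  (fun l T s' => I (l - offset nb v) T s')) => //.
- by rewrite lo offset_mono.
- nia.
- by rewrite lo subnn; apply: I0.
- move=> l T s' _ _ _ fr; have [_ [_ o0' _]] := env_frame kenv fr en.
  by rewrite /= (fr_r _ fr) addn1 o0'.
- rewrite lo => l T s' ll Il r9' fr; apply: wp_seq.
  have ls : l - offset nb v < size (nb v) by lia.
  have [_ [_ _ o1']] := env_frame kenv fr en.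
  have e1 : pval s' (Get 1 9) = nth 0 (nb v) (l - offset nb v).
    by rewrite /= r9' -o1' // subnKC //; case/andP: ll.
  apply: wp_assign.
    rewrite e1; apply: ltn_trans (nb_lt vn (mem_nth _ ls)) _; nia.
  rewrite e1; apply: wp_conseq (hp _ T _ ls Il fr) _ => t s2 f2 I2.
  rewrite subSn; last by case/andP: ll.
  by rewrite (_ : _ + _ + _ = T + t + 14) //=; lia.
- move=> T s' IN _ fr; rewrite (_ : _ + _ + _ + _ = T + 10); last by rewrite /=; lia.
  by apply: hQ fr; move: IN; rewrite -size_off addKn.
Qed.

Lemma wp_swap s u t : reg s 10 = u -> reg s 7 = t -> inverse_on n (arr s 3) (arr s 4) ->
  u < n -> t < n ->
  wp B swap_code s (fun T s' => [/\ T = 18, arr s' 3 = swap_ord (arr s 3) (arr s 4) u t &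
                                arr s' 4 = swap_pos (arr s 3) (arr s 4) u t]).
Proof.
move=> eu et [io ip] un tn.
have B_n m : m < n -> m < B by nia.
have [qn _] := ip u un; have [yn _] := io t tn.
do !(apply: wp_seq; first [apply: wp_assign|apply: wp_put]) => /=; rewrite ?eu ?et; try exact: B_n.
by apply: wp_put; rewrite /= ?eu ?et; [exact: B_n | split].
Qed.

Lemma wp_identity s : env s ->
  wp B identity_code s (fun t s' => t <= 14 * n + 6 /\
     forall p, p < n -> arr s' 3 p = p /\ arr s' 4 p = p).
Proof.
move=> en; have [[e0 _ _ _ _] _] := en.
apply: (@wp_for_le _ _ _ _ _ _ n 6
  (fun l s => forall p, p < l -> arr s 3 p = p /\ arr s 4 p = p)) => //=.
- nia.
- by move=> l s' _ _ _ [fr _]; rewrite fr.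
- move=> l s' ln Il rl _; apply: wp_seq; apply: wp_put => /=; first by rewrite rl; nia.
  apply: wp_put => /=; rewrite rl; first nia.
  split=> // p; rewrite ltnS leq_eqVlt => /predU1P[->|pl]; first by rewrite eqxx.
  by have [-> ->] := Il _ pl; case: eqP.
- by move=> t s' tn IN _ _; split=> //; lia.
Qed.

Lemma wp_deletion_set s : env s -> (forall p, p < n -> arr s 3 p = p /\ arr s 4 p = p) ->
  (forall i, i < d -> arr s 2 i = nth 0 ds i) ->
  wp B deletion_set_code s (fun t s' => [/\ t <= 29 * n + 6, reg s' 7 = d,
     inverse_on n (arr s' 3) (arr s' 4) & forall i, i < d -> arr s' 3 i = nth 0 ds i]).
Proof.
move=> en ids e2; have [[_ _ ed _ _] _] := en; have dn' := dn.
apply: (@wp_for_le _ _ _ _ _ _ d 21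
  (fun l s => inverse_on n (arr s 3) (arr s 4) /\ forall i, i < l -> arr s 3 i = nth 0 ds i)) => //=.
- nia.
- split=> //; split=> p pn; have [h3 h4] := ids p pn; rewrite ?h3 ?h4 ?h3 //.
- by move=> l s' _ _ _ [fr _]; rewrite fr.
- move=> l s' ld [iv Il] rl [fr fa].
  have lds : l < size ds by rewrite size_ds.
  have un : nth 0 ds l < n by apply: ds_lt; apply: mem_nth.
  apply: wp_seq; apply: wp_assign; rewrite /= rl fa // e2 //; first nia.
  set u := nth 0 ds l; set s1 := set_reg _ _ _.
  apply: wp_conseq (@wp_swap s1 u l erefl rl iv un (leq_trans ld dn')) _.
  move=> t s2 _ [-> o2 p2]; split=> //; rewrite -[arr s1]/(arr s') in o2 p2.
  split; first by rewrite /= o2 p2; apply: swap_inverse => //; apply: leq_trans dn'.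
  move=> i; rewrite /= o2 /swap_ord /= ltnS leq_eqVlt => /predU1P[->|il]; first by rewrite eqxx.
  (* The swap disturbs position [i] only if [u] sits there already, against the distinctness of
     [ds]. *)
  rewrite ltn_eqF //; case: eqP => [ei|_]; last exact: Il.
  have [_ ou] := iv.2 u un; rewrite -ei Il // in ou.
  move/eqP: ou; rewrite nth_uniq // ?size_ds ?(ltn_trans il) //.
  by move/eqP => e; rewrite e ltnn in il.
- move=> t s' tn [iv IN] r7 _; split=> //.
  by apply: leq_trans tn _; lia.
Qed.

(** * Graph search with the queue inside the vertex order *)

Definition searched (o po : nat -> nat) tail :=
  forall l, d <= l < tail ->
    (forall l' u, d <= l' < l -> u \in nb (o l') -> po u < l) \/
    (exists2 l', d <= l' < l & o l \in nb (o l')).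

Definition search_state (o po : nat -> nat) p tail :=
  [/\ inverse_on n o po, p <= tail <= n, forall i, i < d -> o i = nth 0 ds i,
      forall l u, d <= l < p -> u \in nb (o l) -> po u < tail & searched o po tail].

(** With an empty queue all neighbours of processed vertices lie before [p], which is the first
    alternative of [searched]. *)
Lemma search_root o po p : d <= p < n -> search_state o po p p -> search_state o po p p.+1.
Proof.
move=> /andP[dp pn] [iv _ ods cl se]; split=> //; first by rewrite leqnSn.
  by move=> l u lp uo; apply: ltnW; apply: cl uo.
move=> l /andP[dl]; rewrite ltnS leq_eqVlt => /predU1P[->|lp]; first by left=> l' u; exact: cl.
by apply: se; rewrite dl.
Qed.

(** The swap moves only positions from [tail] on, so everything known about discovered vertices
    survives; the new one has the earlier neighbour at [p]. *)
Lemma search_enqueue o po p tail u (o' := swap_ord o po u tail) (po' := swap_pos o po u tail) :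
  d <= p < tail -> u < n -> tail <= po u -> u \in nb (o p) -> search_state o po p tail ->
  [/\ search_state o' po' p tail.+1, forall l, l < tail -> o' l = o l,
      forall v, po v < tail -> po' v = po v & po' u = tail].
Proof.
move=> /andP[dp pt] un tu uop [iv /andP[_ tn] ods cl se].
have [pun opu] := iv.2 u un; have tn' : tail < n by apply: leq_ltn_trans pun.
have [otn pot] := iv.1 tail tn'.
have ne a b : a < b -> (a == b) = false by move=> ab; apply/eqP => e; rewrite e ltnn in ab.
have ol l : l < tail -> o' l = o l.
  by move=> lt; rewrite /o' /swap_ord /= !ne // (leq_trans lt).
have pv v : po v < tail -> po' v = po v.
  move=> vt; rewrite /po' /swap_pos /=; case: eqP => [e|_]; first by rewrite e ltnNge tu in vt.
  by case: eqP => // e; rewrite e pot ltnn in vt.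
have pu : po' u = tail by rewrite /po' /swap_pos /= eqxx.
have ot : o' tail = u by rewrite /o' /swap_ord /= eqxx.
split=> //; split.
- exact: swap_inverse.
- by rewrite tn' leqW // ltnW.
- by move=> i id_; rewrite ol ?ods // (leq_trans id_) // (leq_trans dp) // ltnW.
- move=> l w /andP[dl lp] wl; have lt := ltn_trans lp pt.
  rewrite ol // in wl; have wt : po w < tail by apply: cl wl; rewrite dl.
  by rewrite pv // ltnW.
move=> l /andP[dl]; rewrite ltnS leq_eqVlt => /predU1P[->|lt].
  by right; exists p; rewrite ?dp // ot ol.
have dlt : d <= l < tail by rewrite dl.
have [cll|[l' /andP[dl' ll'] ol']] := se l dlt.
  left=> l' w /andP[dl' ll'] wl'; have lt' := ltn_trans ll' lt.
  rewrite ol // in wl'; have wl : po w < l by apply: cll wl'; rewrite dl'.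
  by rewrite pv // (ltn_trans wl).
by right; exists l'; rewrite ?dl' // !ol // (ltn_trans ll').
Qed.

(** The order is a permutation, so the search scans each adjacency list at most once. *)
Lemma sum_ord_le o po p : inverse_on n o po -> p <= n ->
  \sum_(l < p) size (nb (o l)) <= offset nb n.
Proof.
move=> [io ip] pn; pose f l := size (nb (o l)).
have iotaE m (g : nat -> nat) : \sum_(l < m) g l = \sum_(l <- iota 0 m) g l.
  by rewrite -(big_mkord xpredT g) /index_iota subn0.
have -> : offset nb n = \sum_(l < n) f l.
  rewrite /offset (iotaE _ (fun v => size (nb v))) iotaE.
  rewrite -(big_map o xpredT (fun v => size (nb v))).
  apply: perm_big; apply: uniq_perm; first exact: iota_uniq.
    rewrite map_inj_in_uniq ?iota_uniq // => x y; rewrite !mem_iota /= => xn yn e.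
    by rewrite -(io x xn).2 e (io y yn).2.
  move=> v; rewrite mem_iota /=; apply/idP/mapP => [vn|[x]].
    by have [pv ov] := ip v vn; exists (po v); rewrite ?mem_iota.
  by rewrite mem_iota => /io[xn _] ->.
rewrite -!(big_mkord xpredT f) (big_cat_nat (leq0n p) pn) /=.
exact: leq_addr.
Qed.

Lemma wp_search s : env s -> reg s 7 = d -> inverse_on n (arr s 3) (arr s 4) ->
  (forall i, i < d -> arr s 3 i = nth 0 ds i) ->
  wp B search_code s (fun t s' => [/\ t <= 60 * (n + offset nb n) + 10,
     inverse_on n (arr s' 3) (arr s' 4), forall i, i < d -> arr s' 3 i = nth 0 ds i &
     searched (arr s' 3) (arr s' 4) n]).
Proof.
move=> en e7 iv ids; have dn' := dn; have [[e0 _ ed _ _] _] := en.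
pose I p T s := [/\ search_state (arr s 3) (arr s 4) p (reg s 7) &
  T <= 60 * (p - d) + 60 * \sum_(l < p) size (nb (arr s 3 l))].
apply: (@wp_for _ _ _ _ _ _ n I).
- by [].
- by rewrite /= ed.
- nia.
- split; last by [].
  rewrite /= ed e7; split=> //; first by rewrite leqnn.
    by move=> l u; case/andP=> h1 h2; move: (leq_ltn_trans h1 h2); rewrite ltnn.
  by move=> l; case/andP=> h1 h2; move: (leq_ltn_trans h1 h2); rewrite ltnn.
- by move=> l T s' _ _ _ [fr _] /=; rewrite fr.
- rewrite /= ed => p T s' dpn [st Tp] rp fr.
  have en' := env_frame (isT : keeps_env search_code) fr en.
  apply: wp_seq; apply: (@wp_conseq _ _ _ (fun t s1 => t <= 10 /\ [/\ reg s1 6 = p, env s1, p < reg s1 7,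
     search_state (arr s1 3) (arr s1 4) p (reg s1 7) & forall l, arr s1 3 l = arr s' 3 l])).
    have pn : p < n by case/andP: dpn.
    have [_ /andP[pt tn] _ _ _] := st.
    apply: wp_if => /= [|h].
      rewrite rp; case: (eqVneq (reg s' 7) p) => [e _|//]; apply: wp_assign => /=; rewrite e; first nia.
      split=> //; split=> //; rewrite ?addn1 //; rewrite e in st.
      exact: search_root.
    apply: wp_skip; split=> //; split=> //; rewrite ltn_neqAle pt andbT.
    by move: h; rewrite rp eq_sym; case: eqP.
  move=> t1 s1 _ [t1_le [r6 en1 pt st1 o1]].
  have pn : p < n by case/andP: dpn.
  have [iv1 /andP[_ tn1] ods1 _ _] := st1.
  have [vn _] := iv1.1 p pn.
  apply: wp_seq; apply: wp_assign; rewrite /= r6; first nia.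
  set v := arr s1 3 p in vn *; set s2 := set_reg _ _ _.
  pose J l T0 s3 := [/\ p < reg s3 7, T0 <= 60 * l,
     search_state (arr s3 3) (arr s3 4) p (reg s3 7),
     forall l, l <= p -> arr s3 3 l = arr s1 3 l &
     forall i, i < l -> arr s3 4 (nth 0 (nb v) i) < reg s3 7].
  apply: (@wp_scan 8 _ s2 v J) => //.
    move=> l T0 s3 lv [pt3 T3 st3 o3 c3] fr3.
    have un : nth 0 (nb v) l < n by apply: (nb_lt vn); exact: mem_nth.
    have [iv3 /andP[_ tn3] _ _ _] := st3; have [pun _] := iv3.2 _ un.
    apply: wp_if => /= [h|h].
      apply: wp_skip => x; split=> //=; first lia.
      move=> i; rewrite ltnS leq_eqVlt => /predU1P[->|]; last exact: c3.
      by move: h; case: ltnP.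
    have tu : reg s3 7 <= arr s3 4 (nth 0 (nb v) l) by move: h; case: ltnP.
    have t3n : reg s3 7 < n by apply: leq_ltn_trans pun.
    apply: wp_seq; set u := nth 0 (nb v) l in un pun tu *; set s4 := set_reg _ _ _.
    apply: wp_conseq (@wp_swap s4 u (reg s3 7) erefl erefl iv3 un t3n) _.
    move=> t s5 f5 [-> o5 p5]; rewrite -[arr s4]/(arr s3) in o5 p5.
    have r57 : reg s5 7 = reg s3 7 by rewrite f5.1.
    have ol : u \in nb (arr s3 3 p) by rewrite o3 // -/v; exact: mem_nth.
    have dpt : d <= p < reg s3 7 by rewrite pt3 andbT; case/andP: dpn.
    have [st5 o5l p5l p5u] := search_enqueue dpt un tu ol st3.
    rewrite -o5 -p5 in st5 o5l p5l p5u.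
    apply: wp_assign => /=; rewrite r57; first nia.
    move=> x; split; rewrite /= ?addn1 //; first by apply: ltnW.
    - lia.
    - by move=> l' lp; rewrite o5l ?o3 // (leq_ltn_trans lp).
    move=> i; rewrite ltnS leq_eqVlt => /predU1P[->|il]; first by rewrite p5u.
    by rewrite p5l ?c3 // ltnW // ltnS c3.
  move=> T0 s3 [pt3 T3 st3 o3 c3] fr3.
  have [iv3 tn3 ods3 cl3 se3] := st3.
  split; rewrite /=.
    split=> //; first by rewrite pt3; case/andP: tn3.
    move=> l u /andP[dl]; rewrite ltnS leq_eqVlt => /predU1P[->|lp]; last first.
      by apply: cl3; rewrite dl.
    rewrite o3 // -/v => uv; move: (c3 (index u (nb v))).
    by rewrite index_mem nth_index //; apply.
  have sumE : \sum_(l < p.+1) size (nb (arr s3 3 l)) =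
      \sum_(l < p) size (nb (arr s' 3 l)) + size (nb v).
    rewrite big_ord_recr /= o3 //; congr (_ + _).
    by apply: eq_bigr => l _; rewrite o3 ?o1 // ltnW.
  by rewrite sumE; move: dpn; lia.
- move=> T s' [[iv' tn ods' _ se'] TN] _ _; split=> //; last first.
    by have -> : n = reg s' 7 by apply/eqP; rewrite eqn_leq.
  have {TN} := leq_trans TN (leq_add (leqnn _) (leq_mul (leqnn 60) (sum_ord_le iv' (leqnn n)))).
  by rewrite /=; lia.
Qed.

(** * Weights, parents and counts for one trace *)

Definition positions (o po : nat -> nat) p := [seq po u | u <- nb (o p)].

(** The loop runs over vertices, not positions, so the scanned lengths add up to [offset nb v]; the
    results are stored under the position of the vertex. *)
Lemma wp_neighbours s (na := positions (arr s 3) (arr s 4)) : env s ->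
  inverse_on n (arr s 3) (arr s 4) -> (forall i, arr s 5 i <= 1) ->
  wp B neighbours_code s (fun t s' => t <= 60 * (n + offset nb n) + 10 /\
    forall p, p < n -> [/\ arr s' 6 p = fixed_weight d na (arr s 5) p,
                          arr s' 7 p = par d na p & arr s' 8 p = cnt d na p]).
Proof.
move=> en iv xs1; have dn' := dn; have [[e0 _ _ _ _] _] := en.
pose ok s' p := [/\ arr s' 6 p = fixed_weight d na (arr s 5) p,
                   arr s' 7 p = par d na p & arr s' 8 p = cnt d na p].
pose I v T s' := T <= 60 * v + 60 * offset nb v /\
  forall w, w < v -> ok s' (arr s 4 w).
apply: (@wp_for _ _ _ _ _ _ n I) => //=.
- nia.
- by move=> l T s' _ _ _ [fr _]; rewrite fr.
- move=> v T s' vn [Tv Iv] rv fr; have en' := env_frame (isT : keeps_env neighbours_code) fr en.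
  have [pn opv] := iv.2 v vn; set p := arr s 4 v in pn opv *.
  have a4 : arr s' 4 = arr s 4 by rewrite fr.2.
  have a5 : arr s' 5 = arr s 5 by rewrite fr.2.
  have [[_ _ ed _ _] _] := en'.
  do !(apply: wp_seq; apply: wp_assign; rewrite /=; first by rewrite ?rv ?a4 -/p; nia).
  apply: wp_seq; set s1 := set_reg _ 16 _.
  have nap : na p = map (arr s 4) (nb v) by rewrite /na /positions opv.
  have size_nap : size (na p) = size (nb v) by rewrite nap size_map.
  pose J l T0 s2 := [/\ reg s2 13 = p, reg s2 14 = \sum_(q <- take l (na p) | (q < p) && (q < d)) arr s 5 q,
    reg s2 15 = \max_(q <- take l (na p) | earlier d p q) q, reg s2 16 = count (earlier d p) (take l (na p))
    & T0 <= 60 * l].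
  apply: (@wp_scan 6 _ s1 v J) => //.
  + move=> x; split=> //=; rewrite ?take0 ?big_nil //; by rewrite rv a4.
  + move=> l T0 s2 lv [r13 r14 r15 r16 T2] f2.
    have a42 : arr s2 4 = arr s 4 by rewrite f2.2.
    have a52 : arr s2 5 = arr s 5 by rewrite f2.2.
    have ed2 : reg s2 2 = d by rewrite f2.1.
    have un : nth 0 (nb v) l < n by apply: (nb_lt vn); exact: mem_nth.
    have qn := (iv.2 _ un).1.
    apply: wp_seq; apply: wp_assign; rewrite /= a42; first nia.
    set q := arr s 4 _ in qn *.
    have tl : take l.+1 (na p) = rcons (take l (na p)) q.
      by rewrite (take_nth 0) ?size_nap // nap (nth_map 0).
    have st : [/\ \sum_(q <- take l.+1 (na p) | (q < p) && (q < d)) arr s 5 q =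
         reg s2 14 + (if (q < p) && (q < d) then arr s 5 q else 0),
       \max_(q <- take l.+1 (na p) | earlier d p q) q = maxn (reg s2 15) (if earlier d p q then q else 0) &
       count (earlier d p) (take l.+1 (na p)) = reg s2 16 + earlier d p q].
      rewrite tl r14 r15 r16 -cats1 !big_cat count_cat !big_cons !big_nil /= addn0 maxn0.
      by case: (_ && _); case: (_ && _); rewrite ?addn0.
    have c16 : reg s2 16 <= n.
      rewrite r16; apply: leq_trans (count_size _ _) _; rewrite size_take size_nap lv.
      exact: leq_trans (ltnW lv) (size_nb vn).
    have w14 : reg s2 14 <= n.
      rewrite r14; apply: leq_trans (_ : size (take l (na p)) <= n).
        rewrite -sum1_size big_mkcond; apply: leq_sum => j _; case: ifP => // _; exact: xs1.
      rewrite size_take size_nap lv; exact: leq_trans (ltnW lv) (size_nb vn).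
    have [st14 st15 st16] := st.
    apply: wp_if => /= [/nat_of_bool_neq0 qp|/nat_of_bool_eq0 qp]; rewrite r13 in qp.
      apply: wp_if => /= [/nat_of_bool_neq0 qd|/nat_of_bool_eq0 qd]; rewrite ed2 in qd.
        apply: wp_assign; rewrite /= a52; first by move: (xs1 q); nia.
        have dq : (d <= q) = false by apply/negbTE; rewrite -ltnNge.
        move=> x; split; rewrite /= ?st14 ?st15 ?st16 /= ?qp ?qd ?dq ?maxn0 ?addn0 //; lia.
      have dq : d <= q by rewrite leqNgt qd.
      apply: wp_seq; apply: wp_assign; first by rewrite /=; nia.
      apply: wp_if => /= [/nat_of_bool_neq0 lt15|/nat_of_bool_eq0 lt15].
        apply: wp_assign; first by rewrite /=; nia.
        move=> x; split; rewrite /= ?st14 ?st15 ?st16 /= ?qp ?qd ?dq ?addn0 //; last lia.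
        by apply/esym/maxn_idPr; exact: ltnW.
      apply: wp_skip => x; split; rewrite /= ?st14 ?st15 ?st16 /= ?qp ?qd ?dq ?addn0 //; last lia.
      by apply/esym/maxn_idPl; rewrite leqNgt lt15.
    apply: wp_skip => x; split; rewrite /= ?st14 ?st15 ?st16 /= ?qp ?andbF ?maxn0 ?addn0 //; lia.
  + move=> T0 s2 [r13 r14 r15 r16 T2] f2.
    rewrite !take_oversize ?size_nap // in r14 r15 r16.
    have c16 : reg s2 16 <= n.
      rewrite r16; apply: leq_trans (count_size _ _) _; rewrite size_nap; exact: size_nb.
    have w14 : reg s2 14 <= n.
      rewrite r14; apply: leq_trans (_ : size (na p) <= n).
        rewrite -sum1_size big_mkcond; apply: leq_sum => j _; case: ifP => // _; exact: xs1.
      rewrite size_nap; exact: size_nb.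
    have w15 : reg s2 15 <= n.
      rewrite r15; apply: (@leq_trans p); last exact: ltnW.
      by elim/big_ind: _ => // [x y xp yp|q /andP[_ /ltnW]] //; rewrite geq_max xp.
    do 2 (apply: wp_seq; apply: wp_put; rewrite /=; first nia).
    apply: wp_put; rewrite /=; first nia.
    have f6 : forall a, a \in [:: 6; 7; 8] -> arr s2 a = arr s' a.
      by move=> a; rewrite !inE => /or3P[]/eqP->; rewrite f2.2.
    split; first by rewrite offsetS; lia.
    move=> w; rewrite ltnS leq_eqVlt => /predU1P[->|wv]; rewrite /ok /= r13.
      by rewrite -/p eqxx r14 r15 r16.
    have [_ opw] := iv.2 w (ltn_trans wv vn).
    case: eqP => [e|_]; last by rewrite !f6 //; exact: Iv.
    by move: wv; rewrite -opw e opv ltnn.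
- move=> T s' [TN IN] _ _; split; first lia.
  by move=> p pn; have [un <-] := iv.1 p pn; exact: IN.
Qed.

Lemma positions_uniq o po p : inverse_on n o po -> p < n -> uniq (positions o po p).
Proof.
move=> [io ip] pn; have [vn _] := io p pn; rewrite map_inj_in_uniq ?nb_uniq // => u w un wn e.
by rewrite -(ip u (nb_lt vn un)).2 e (ip w (nb_lt vn wn)).2.
Qed.

Lemma positions_lt o po p q : inverse_on n o po -> p < n -> q \in positions o po p -> q < n.
Proof.
move=> [io ip] pn /mapP[u un ->]; have [vn _] := io p pn.
exact: (ip u (nb_lt vn un)).1.
Qed.

(** * Filling, folding and backtracking the tables *)

Definition holds_table s (T : nat -> nat -> nat) :=
  forall v x, v < n -> x < QK -> arr s 9 (v * QK + x) = T v x.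

Lemma wp_local s na : env s -> (forall p, p < n -> uniq (na p)) ->
  (forall p q, p < n -> q \in na p -> q < n) -> (forall i, arr s 5 i <= 1) ->
  (forall p, p < n -> arr s 6 p = fixed_weight d na (arr s 5) p) ->
  wp B (local_code dense) s (fun t s' => t <= 80 * (n * QK) + 10 /\
    holds_table s' (local n k d na dense (arr s 5))).
Proof.
move=> en una lna xs1 a6; have [[e0 _ _ _ e4] _] := en; have dn' := dn.
have QK0 : 0 < QK by rewrite /QK /K.
have QKn := table_size_lt.
apply: (@wp_for_le _ _ _ _ _ _ (n * QK) 68
  (fun l s' => forall v x, v < n -> x < QK -> v * QK + x < l ->
     arr s' 9 (v * QK + x) = local n k d na dense (arr s 5) v x)) => //=.
- nia.
- by move=> l s' _ _ _ [fr _]; rewrite !fr // e0 e4.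
- move=> l s' ln Il rl fr; have [[e0' e1' e2' e3' e4'] [e5' _ _]] := env_frame (isT : keeps_env (local_code dense)) fr en.
  set v := l %/ QK; set x := l %% QK.
  have vn : v < n by rewrite ltn_divLR.
  have xQ : x < QK by rewrite ltn_mod.
  have le := local_le dense k0 kn dn' una lna xs1 vn xQ.
  have xK : x %/ K <= x by exact: leq_div.
  do 3 (apply: wp_seq; apply: wp_assign; rewrite /= ?rl ?e3' ?e4' -/v -/x; first nia).
  have e : pval (set_reg (set_reg (set_reg s' 7 v) 8 x) 10 (x %/ K))
     ((8 %' 3 =' 10 %' Lit 2) *' (Lit 1 -' (7 <' 2) *' (Lit 1 -' (Get 5 7 =' 10 %' Lit 2))) *'
        (5 +' 10 %' Lit 2 *' Bin (if dense then OpAdd else OpSub) 0 (Get 6 7 +' 10 /' Lit 2))) =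
     local n k d na dense (arr s 5) v x.
    rewrite /local /signed /= e0' e2' e3' e5' -a6 // !fr.2 //.
  apply: wp_put; rewrite e; first nia.
  split; first by [].
  move=> w y wn yQ; rewrite ltnS leq_eqVlt /= rl => /predU1P[el|lt]; last first.
    by rewrite ltn_eqF // Il.
  rewrite el eqxx /v /x -el divnMDl // divn_small // addn0 modnMDl modn_small //.
- move=> t s' tn IN _ _; split=> [|v x vn xQ]; first lia.
  by apply: IN => //; nia.
Qed.

Section Tables.
Variables (pa cn : nat -> nat) (lo : nat -> nat -> nat).
Hypothesis pa_lt : forall c, 0 < c < n -> pa c < c.
Hypothesis lo_le : forall v x, v < n -> x < QK -> lo v x <= M + 3 * n.
Let tab := table n k pa cn lo.
Let n0 : 0 < n. Proof. exact: leq_trans kn. Qed.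

Lemma tab_lt m v x : 0 < m <= n -> v < n -> x < QK -> 3 * tab m v x < B.
Proof.
move=> mn vn xQ; apply: leq_ltn_trans table_value_lt; rewrite leq_mul2l /=.
by have := table_bound cn n0 k0 pa_lt lo_le mn vn xQ.
Qed.

Lemma pval_gain s T c x i (j : nat) (r : nat) : holds_table s T ->
  reg s 14 = pa c * QK + x -> reg s 15 = c * QK + 2 * i * K ->
  reg s 16 = c * QK + 2 * i * K + K -> reg s r = j -> i = ctx k cn c (x %/ K) ->
  c < n -> pa c < n -> x < QK -> j <= x %% K ->
  pval s (gain_expr r) = gain k pa cn T c x j.
Proof.
move=> hT e14 e15 e16 er ei cN pN xQ jx; rewrite /= e14 e15 e16 er.
have jk : j <= k by apply: leq_trans jx _; rewrite -ltnS ltn_mod.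
have jxx : j <= x by apply: leq_trans jx _; exact: leq_mod.
have i0 := ctx_index (cnt := cn) (q := x %/ K) n0 k0 ei jk (leq0n 1).
have i1 := ctx_index (cnt := cn) (q := x %/ K) n0 k0 ei jk (leqnn 1).
rewrite mul0n addn0 in i0; rewrite mul1n in i1.
rewrite -addnBA // hT ?(leq_ltn_trans (leq_subr _ _)) // -!addnA !hT ?addnA //.
by rewrite /gain /better -ei addnA.
Qed.

Lemma wp_fold s : env s -> (forall p, p < n -> arr s 7 p = pa p) ->
  (forall p, p < n -> arr s 8 p = cn p) -> holds_table s lo ->
  wp B fold_code s (fun t s' => [/\ t <= 100 * (n * QK * K) + 200 * n * QK + 100 * n + 10,
    holds_table s' (tab 1) &
    forall c x, 0 < c < n -> x < QK -> arr s' 10 (c * QK + x) = choice k pa cn (tab c.+1) c x]).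
Proof.
move=> en a7 a8 tl; have [[e0 _ _ _ _] _] := en.
have QK0 : 0 < QK by rewrite /QK /K.
have QKn := table_size_lt.
apply: (@wp_for_le _ _ _ _ _ _ n (QK * (60 * K + 140) + 40)
  (fun l s' => holds_table s' (tab (n - l).+1) /\
     forall c x, n - l < c < n -> x < QK -> arr s' 10 (c * QK + x) = choice k pa cn (tab c.+1) c x)) => //=.
- nia.
- split; last by move=> c x; lia.
  by rewrite subn1 prednK // /tab table_n.
- by move=> l s' _ _ _ [fr _]; rewrite fr.
- move=> l s' /andP[l0 ln] [hT hC] rl fr; have en' := env_frame (isT : keeps_env fold_code) fr en.
  have [[e0' e1' _ e3' e4'] _] := en'.
  have a7' : arr s' 7 = arr s 7 by rewrite fr.2.
  have a8' : arr s' 8 = arr s 8 by rewrite fr.2.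
  set c := n - l in hT hC *; have c0n : 0 < c < n by lia.
  have cN : c < n by lia.
  have pc := pa_lt c0n; have pN := ltn_trans pc cN.
  apply: wp_seq; apply: wp_assign; rewrite /= e0' rl -/c; first nia.
  apply: wp_seq; apply: wp_assign; rewrite /= a7' a7 //; first nia.
  set s1 := set_reg _ 8 _.
  have en1 : env s1 by exact: en'.
  have Tb v x : v < n -> x < QK -> 3 * tab c.+1 v x < B by apply: tab_lt; lia.
  pose J l' s2 := [/\ forall v x, v < n -> x < QK -> arr s2 9 (v * QK + x) =
      if (v == pa c) && (QK - l' <= x) then tab c v x else tab c.+1 v x,
    forall x, QK - l' <= x -> x < QK -> arr s2 10 (c * QK + x) = choice k pa cn (tab c.+1) c x &
    forall c' x, c < c' < n -> x < QK -> arr s2 10 (c' * QK + x) = choice k pa cn (tab c'.+1) c' x].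
  apply: (@wp_for_le _ _ _ _ _ _ QK (60 * K + 130) J) => //=.
  + by rewrite /QK /K; nia.
  + split=> //.
      by move=> v x vn xQ /=; rewrite subn0 [QK <= x]leqNgt xQ andbF hT.
    by move=> x; rewrite subn0 => + xQ; rewrite leqNgt xQ.
  + by move=> l' s2 _ _ _ [f2 _]; rewrite f2.
  + move=> l' s2 l'Q [h9 h10 h10'] rl' f2.
    have [[_ e1'' _ e3'' e4''] _] : env s2 by apply: env_frame f2 en1.
    have r7 : reg s2 7 = c by rewrite f2.1.
    have r8 : reg s2 8 = pa c by rewrite f2.1.
    have a8'' : arr s2 8 c = cn c by rewrite f2.2 //= a8' a8.
    set x := QK - 1 - l'; have xQ : x < QK by lia.
    have eQ : QK - l'.+1 = x by lia.
    have xlt : QK - l' = x.+1 by lia.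
    pose T v y := if (v == pa c) && (x < y) then tab c v y else tab c.+1 v y.
    pose g := gain k pa cn (tab c.+1) c x.
    (* The partly overwritten table gives the same gains: the row of the parent is read at indices
       up to [x] only, and row [c] is a different row. *)
    have gT j : j <= x %% K -> gain k pa cn T c x j = g j.
      move=> jx; rewrite /g /gain /better /T eqxx /= (gtn_eqF pc) /=.
      by rewrite ltnNge leq_subr.
    set i := ctx k cn c (x %/ K).
    have ik : i <= k by exact: ctx_le.
    have i0 := ctx_index (cnt := cn) (q := x %/ K) n0 k0 (erefl i) (leq0n k) (leq0n 1).
    have i1 := ctx_index (cnt := cn) (q := x %/ K) n0 k0 (erefl i) (leq0n k) (leqnn 1).
    rewrite mul0n !addn0 -/K -/QK in i0; rewrite mul1n addn0 -/K -/QK in i1.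
    have idx v y : v < n -> y < QK -> v * QK + y < n * QK.
      by move=> vn yQ; apply: (@leq_trans (v.+1 * QK)); rewrite ?leq_mul2r ?vn ?orbT // mulSn addnC ltn_add2r.
    have xKx : x %/ K <= x by exact: leq_div.
    apply: wp_seq; apply: wp_assign; rewrite /= e4'' rl' -/x; first lia.
    apply: wp_seq; apply: wp_assign; rewrite /= e3''; first lia.
    apply: wp_seq; apply: wp_assign; rewrite /= r7 a8'' e1'' -/(ctx k cn c (x %/ K)) -/i; first lia.
    apply: wp_seq; apply: wp_assign; rewrite /= r8 e4''; first by have := idx _ _ pN xQ; lia.
    apply: wp_seq; apply: wp_assign; rewrite /= r7 e4'' e3''; first by have := idx _ _ cN i0; lia.
    apply: wp_seq; apply: wp_assign; rewrite /= e3''; first by have := idx _ _ cN i1; lia.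
    apply: wp_seq; apply: wp_assign; rewrite /=; first lia.
    apply: wp_seq; set s3 := set_reg _ 17 _.
    have gE s4 r j : frame (For 18 (Lit 0) (10 %' 3 +' Lit 1)
          (If (gain_expr 18 <' gain_expr 17) Skip (17 ::= 18))) s3 s4 ->
        reg s4 r = j -> j <= x %% K -> pval s4 (gain_expr r) = g j.
      move=> [f4 f4'] rj jx; rewrite -gT //; apply: pval_gain (rj) _ cN pN xQ jx => //; rewrite ?f4 //.
      by move=> v y vn yQ; rewrite f4' //= h9 // xlt.
    have xm : (x %% K).+1 <= K by rewrite ltn_mod.
    apply: (@wp_for_le _ _ _ _ _ _ (x %% K).+1 42 (fun l s4 => reg s4 17 = amax g l)) => //=.
    * by rewrite /K in xm *; lia.
    * by move=> l4 s4 _ _ _ [f4 _]; rewrite !f4 //= e3'' addn1.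
    * move=> l4 s4 l4x r17 r18 f4.
      have l4x' : l4 <= x %% K by [].
      have amx : amax g l4 <= x %% K.
        by case: (l4) l4x' => [//|m] mx; apply: leq_trans (ltnW mx); have [] := @amaxP g m.+1 isT.
      apply: wp_if;
        rewrite -[pval s4 _]/(nat_of_bool (pval s4 (gain_expr 18) < pval s4 (gain_expr 17)))
          (gE s4 18 _ f4 r18) // (gE s4 17 _ f4 r17) //.
        by move/nat_of_bool_neq0 => lt; apply: wp_skip; split=> //=; rewrite leqNgt lt.
      move/nat_of_bool_eq0 => lt; apply: wp_assign; first by rewrite /= r18; lia.
      by split=> //=; rewrite leqNgt lt r18.
    * move=> t s4 tn r17 _ f4; have amx : amax g (x %% K).+1 <= x %% K by have [] := @amaxP g (x %% K).+1 isT.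
      have {}r17 : reg s4 17 = amax g (x %% K).+1 := r17.
      have val : g (amax g (x %% K).+1) = tab c (pa c) x by rewrite /tab tableS // fold_par.
      have chE : amax g (x %% K).+1 = choice k pa cn (tab c.+1) c x by [].
      rewrite {}chE in r17 amx val; set am := choice _ _ _ _ _ _ in r17 amx val.
      apply: wp_seq; apply: wp_put; rewrite (gE s4 17 _ f4 r17) // val.
        by have := @tab_lt c (pa c) x; lia.
      have [f4r f4a] := f4.
      have r14 : reg s4 14 = pa c * QK + x by rewrite f4r.
      have r7' : reg s4 7 = c by rewrite f4r.
      have r4' : reg s4 4 = QK by rewrite f4r.
      have r10 : reg s4 10 = x by rewrite f4r.
      rewrite /= r14; apply: wp_put; rewrite /= r17; first by have := leq_mod x K; lia.
      rewrite r7' r4' r10; split; first by lia.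
      split=> [v y vn yQ|y xy yQ|c' y c'n yQ] /=.
      - rewrite index_inj //; case: eqP => [->|nv] /=; last by rewrite f4a //= h9 //; case: eqP.
        case: (eqVneq y x) => [->|ne]; first by rewrite /= eQ leqnn.
        by rewrite /= f4a //= h9 // eqxx eQ xlt ltn_neqAle [x == y]eq_sym ne.
      - rewrite eqn_add2l; case: (eqVneq y x) => [->|ne]; first by [].
        by rewrite f4a //= h10 // xlt ltn_neqAle eq_sym ne -eQ.
      - by rewrite index_inj // gtn_eqF ?f4a //= ?h10' //; case/andP: c'n.
  + move=> t s2 tn [h9 h10 h10'] _ f2; split; first by rewrite /=; lia.
    have -> : (n - l.+1).+1 = c by lia.
    split=> [v x vn xQ|c' x c'n xQ] /=.
      rewrite h9 // subnn leq0n andbT; case: eqVneq => // vp.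
      by rewrite /tab [in RHS]tableS // fold_other.
    have [<-|cc] := eqVneq c c'; first by rewrite h10 // subnn.
    by rewrite h10' //; move: cc c'n; rewrite neq_ltn; lia.
- move=> t s' tn [hT hC] _ _; rewrite subnn in hT hC; split=> //.
  by apply: leq_trans tn _; nia.
Qed.

Lemma table_index v x : v < n -> x < QK -> v * QK + x < n * QK.
Proof.
move=> vn xQ; apply: (@leq_trans (v.+1 * QK)); last by rewrite leq_mul2r vn orbT.
by rewrite mulSn addnC ltn_add2r.
Qed.

Lemma wp_backtrack s : env s -> (forall p, p < n -> arr s 7 p = pa p) ->
  (forall p, p < n -> arr s 8 p = cn p) -> holds_table s (tab 1) ->
  (forall c x, 0 < c < n -> x < QK -> arr s 10 (c * QK + x) = choice k pa cn (tab c.+1) c x) ->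
  wp B backtrack_code s (fun t s' => t <= 150 * n + 30 /\
    forall v, v < n -> arr s' 11 v = (backtrack n k pa cn lo n.-1).1 v).
Proof.
move=> en a7 a8 hT hC; have [[e0 e1 _ e3 _] _] := en.
have QKn := table_size_lt.
have KQK : 2 * K <= QK by rewrite /QK leq_pmulr.
have kQ : k < QK by apply: leq_trans KQK; rewrite /K; lia.
have KkQ : K + k < QK by apply: leq_trans KQK; rewrite /K; lia.
have h0 x : x < QK -> arr s 9 x = tab 1 0 x by move=> xQ; rewrite -hT // mul0n.
apply: wp_seq; apply: wp_put; rewrite /= e1 e3 !h0 //; first by apply: leq_ltn_trans (leq_b1 _) _; lia.
apply: wp_seq; apply: wp_put; rewrite /= e1; first lia.
set s0 := set_arr _ 12 _ _; have en0 : env s0 by exact: en.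
pose bt := backtrack n k pa cn lo.
apply: (@wp_for_le _ _ _ _ _ _ n 100
  (fun l s => forall v, v < l -> arr s 11 v = (bt l.-1).1 v /\ arr s 12 v = (bt l.-1).2 v)) => //=.
- lia.
- by case.
- by move=> l s' _ _ _ [fr _]; rewrite fr.
- move=> [//|m] s' mn0 Il rl fr; have mn : m.+1 < n by case/andP: mn0.
  have [[_ e1' _ e3' e4'] _] : env s' by apply: env_frame fr en0.
  have mN : m < n by apply: ltnW.
  pose q := (bt m).1; pose J := (bt m).2.
  have [[q0 vq] Jk _] := @backtrackP n k pa cn lo n0 k0 pa_lt m mN.
  rewrite -/bt -/q -/J in q0 vq Jk.
  have {}Il : forall v, v < m.+1 -> arr s' 11 v = q v /\ arr s' 12 v = J v := Il.
  have c0n : 0 < m.+1 < n by rewrite mn.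
  set t := pa m.+1; have tm : t < m.+1 by exact: pa_lt.
  have tn : t < n by apply: ltn_trans tm mn.
  have q_lt v : v < m.+1 -> q v %/ 2 <= k.
    by case: v => [|v] vm; [rewrite q0 | rewrite vq //; exact: ctx_le].
  have Jt : J t <= k by rewrite -Jk (bigD1 (Ordinal tm)) //= leq_addr.
  have qt : q t < 2 * K.
    by move: (q_lt t tm) (divn_eq (q t) 2) (ltn_pmod (q t) (isT : 0 < 2)); rewrite /K; lia.
  have xQ : q t * K + J t < QK.
    apply: (@leq_trans ((q t).+1 * K)); last by rewrite /QK leq_mul2r qt orbT.
    by rewrite mulSn addnC ltn_add2r ltnS.
  have [Qt Jt'] := Il t tm; have a7' : arr s' 7 m.+1 = t by rewrite fr.2 //= a7.
  have a8' : arr s' 8 m.+1 = cn m.+1 by rewrite fr.2 //= a8.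
  have a9' : arr s' 9 = arr s 9 by rewrite fr.2.
  have a10' : arr s' 10 = arr s 10 by rewrite fr.2.
  pose j := choice k pa cn (tab m.+2) m.+1 (q t * K + J t).
  pose i := ctx k cn m.+1 (q t).
  have ik : i <= k by exact: ctx_le.
  have jx : j <= q t * K + J t.
    have [h _] := @amaxP (gain k pa cn (tab m.+2) m.+1 (q t * K + J t)) ((q t * K + J t) %% K).+1 isT.
    by rewrite -ltnS; apply: leq_trans h _; rewrite ltnS leq_mod.
  have jk : j <= k.
    have [h _] := @amaxP (gain k pa cn (tab m.+2) m.+1 (q t * K + J t)) ((q t * K + J t) %% K).+1 isT.
    by rewrite -ltnS; apply: leq_trans h _; rewrite ltn_mod.
  have i0 := ctx_index (cnt := cn) (q := q t) n0 k0 (erefl i) jk (leq0n 1).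
  have i1 := ctx_index (cnt := cn) (q := q t) n0 k0 (erefl i) jk (leqnn 1).
  rewrite mul0n !addn0 -/K -/QK in i0; rewrite mul1n -/K -/QK in i1.
  have idx0 := table_index mn i0; have idx1 := table_index mn i1; have idx := table_index mn xQ.
  set b := tab 1 m.+1 (2 * i * K + j) < tab 1 m.+1 (2 * i * K + K + j).
  have btE : bt m.+1 = (upd q m.+1 (2 * i + b), upd (upd J t (J t - j)) m.+1 j).
    by rewrite /b /i /j /q /J /bt /=; case: backtrack.
  clearbody q J bt.
  apply: wp_seq; apply: wp_assign; rewrite /= rl a7'; first lia.
  apply: wp_seq; apply: wp_assign; rewrite /= Qt; first lia.
  apply: wp_seq; apply: wp_assign; rewrite /= rl a8' e1' -/(ctx k cn m.+1 (q t)) -/i; first lia.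
  apply: wp_seq; apply: wp_assign; rewrite /= rl e4'; first lia.
  apply: wp_seq; apply: wp_assign; rewrite /= e3'; first lia.
  apply: wp_seq; apply: wp_assign; rewrite /= e3' Jt' a10' hC // -/j; first lia.
  apply: wp_seq; apply: wp_put; rewrite /= Jt'; first lia.
  apply: wp_seq; apply: wp_put; rewrite /=; first lia.
  have F0 : arr s 9 (m.+1 * QK + 2 * i * K + j) = tab 1 m.+1 (2 * i * K + j).
    by rewrite -hT // addnA.
  have F1 : arr s 9 (m.+1 * QK + 2 * i * K + K + j) = tab 1 m.+1 (2 * i * K + K + j).
    by rewrite -hT // !addnA.
  have b1 : b <= 1 by case: (b).
  apply: wp_put; rewrite /= e3' a9' F0 F1 -/b; first lia.
  split=> // v; rewrite btE ltnS leq_eqVlt rl /= => /predU1P[->|vm].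
    by rewrite eqxx.
  by have [-> ->] := Il v vm; rewrite !(ltn_eqF vm).
- by move=> t s' tn IN _ _; split=> [|v vn]; [lia | have [] := IN v vn].
Qed.
End Tables.

(** * Enumeration of the traces *)

Lemma wp_next_subset s r : env s -> r < 2 ^ d -> (forall i, i < d -> arr s 5 i = r %/ 2 ^ i %% 2) ->
  wp B next_subset_code s (fun t s' => [/\ t <= 30 * n + 20, reg s' 11 = (r.+1 == 2 ^ d),
     forall i, i < d -> arr s' 5 i = r.+1 %/ 2 ^ i %% 2 &
     forall i, d <= i -> arr s' 5 i = arr s 5 i]).
Proof.
move=> en rd xsr; have [[_ _ e2 _ _] _] := en; have dn' := dn.
have nB : n < B by nia.
apply: wp_seq; apply: wp_assign; rewrite /=; first lia.
(* A carry enters bit [l] iff the [l] lower bits of [r] are all 1, that is, iff 2^l divides r +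
   1. *)
apply: wp_seq; apply: (@wp_for_le _ _ _ _ _ _ d 16
  (fun l s' => [/\ reg s' 13 = (2 ^ l %| r.+1),
     forall i, i < d -> arr s' 5 i = (if i < l then r.+1 else r) %/ 2 ^ i %% 2 &
     forall i, d <= i -> arr s' 5 i = arr s 5 i])) => //=.
- lia.
- by split=> //; rewrite expn0 dvd1n.
- by move=> l s' _ _ _ [fr _]; rewrite fr.
- move=> l s' ld [r13 bl hi] rl _.
  have P0 : 0 < 2 ^ l by rewrite expn_gt0.
  have step : r.+1 %/ 2 ^ l = (2 ^ l %| r.+1) + r %/ 2 ^ l by exact: divnS.
  have carry : (r %/ 2 ^ l %% 2 + (2 ^ l %| r.+1)) %/ 2 = (2 ^ l.+1 %| r.+1).
    have : r.+1 %/ 2 ^ l.+1 = (2 ^ l.+1 %| r.+1) + r %/ 2 ^ l.+1 by rewrite divnS // expn_gt0.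
    rewrite expnSr !divnMA step; move: (r %/ 2 ^ l) => a.
    rewrite {1}(divn_eq a 2) addnCA divnMDl // addnC [(_ %| _) + a %% 2]addnC.
    by move/addIn.
  have s_le : r %/ 2 ^ l %% 2 + (2 ^ l %| r.+1) <= 2.
    by move: (ltn_pmod (r %/ 2 ^ l) (isT : 0 < 2)); case: (_ %| _); lia.
  apply: wp_seq; apply: wp_assign; rewrite /= rl bl // ltnn r13; first lia.
  apply: wp_seq; apply: wp_put; rewrite /=.
    by apply: leq_ltn_trans (leq_mod _ _) _; lia.
  apply: wp_assign; rewrite /= carry.
    by apply: leq_ltn_trans (leq_b1 _) _; lia.
  split=> //; split=> //= i id_; rewrite rl.
    have [->|il] := eqVneq i l; first by rewrite ltnSn step modnDml addnC.
    by rewrite bl // ltnS [i <= l]leq_eqVlt (negPf il).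
  by rewrite gtn_eqF ?hi // (leq_trans ld).
- move=> t s' tn [r13 bl hi] _ _; apply: wp_assign; rewrite /= r13.
    by apply: leq_ltn_trans (leq_b1 _) _; lia.
  split=> //; first by lia.
    (* As r < 2^d, the number r + 1 is a multiple of 2^d only if it equals 2^d. *)
    congr nat_of_bool; apply/idP/eqP => [h|->]; last exact: dvdnn.
    by apply/eqP; rewrite eqn_leq rd dvdn_leq.
  by move=> i id_; rewrite bl ?id_.
Qed.

Lemma wp_output s (sel := [seq arr s 3 p | p <- iota 0 n & odd (arr s 11 p)]) : reg s 0 = n ->
  (forall p, p < n -> arr s 3 p < n) ->
  wp B output_code s (fun t s' => [/\ t <= 40 * n + 20, reg s' 0 = 1 &
     forall i, i < size sel -> arr s' 0 i = nth 0 sel i]).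
Proof.
move=> e0 on; have nB : n < B by nia.
pose sl l := [seq arr s 3 p | p <- iota 0 l & odd (arr s 11 p)].
apply: wp_seq; apply: wp_assign; rewrite /=; first lia.
apply: wp_seq; apply: (@wp_for_le _ _ _ _ _ _ n 18
  (fun l s' => reg s' 7 = size (sl l) /\
     forall i, i < size (sl l) -> arr s' 0 i = nth 0 (sl l) i)) => //=.
- by move=> l s' _ _ _ [fr _]; rewrite fr.
- move=> l s' ln [r7 h0] rl [_ fa].
  have a3 : arr s' 3 = arr s 3 by rewrite fa.
  have a11 : arr s' 11 = arr s 11 by rewrite fa.
  have size_l : size (sl l) <= l.
    by rewrite size_map size_filter; apply: leq_trans (count_size _ _) _; rewrite size_iota.
  have slS : sl l.+1 = if odd (arr s 11 l) then rcons (sl l) (arr s 3 l) else sl l.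
    by rewrite /sl -[l.+1]addn1 iotaD filter_cat map_cat /= add0n; case: odd; rewrite /= ?cats1 ?cats0.
  apply: wp_if => /=; rewrite rl a11 modn2.
    move/nat_of_bool_neq0 => od; rewrite od in slS.
    apply: wp_seq; apply: wp_put; rewrite /= rl a3; first by apply: ltn_trans nB; exact: on.
    apply: wp_assign; rewrite /= r7; first lia.
    split=> //; rewrite slS size_rcons addn1; split=> // i.
    rewrite /= nth_rcons ltnS leq_eqVlt => /predU1P[->|il]; first by rewrite eqxx ltnn.
    by rewrite (ltn_eqF il) il h0.
  by move/nat_of_bool_eq0 => od; rewrite od in slS; apply: wp_skip; rewrite slS.
- move=> t s' tn [r7 h0] _ _; apply: wp_assign; rewrite /=; first lia.
  by split=> //; lia.
Qed.

(** Thus the counter meets the trace of every selection. *)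
Lemma bits_exist (b : nat -> bool) m : exists2 r, r < 2 ^ m & forall i, i < m -> r %/ 2 ^ i %% 2 = b i.
Proof.
elim: m b => [|m IH] b; first by exists 0.
have [r rm rb] := IH (b \o S); exists (2 * r + b 0).
  by rewrite expnS; case: (b 0); lia.
case=> [|i] im; first by rewrite expn0 divn1 mod2D.
by rewrite expnS divnMA half2D rb.
Qed.

Definition value (na : nat -> seq nat) (b : nat -> bool) :=
  \sum_(p < n) b p * signed n dense (degree na b p).

Lemma eq_value na b b' : (forall p q, p < n -> q \in na p -> q < n) ->
  (forall p, p < n -> b p = b' p) -> value na b = value na b'.
Proof.
move=> lna e; apply: eq_bigr => p _; rewrite e //; congr (_ * signed _ _ _).
by apply: eq_in_count => q qp; rewrite e // (lna p).
Qed.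

(** The order is computed at run time, so the graph-theoretic input is assumed for every order that
    a search can leave behind. *)
Hypothesis structure_of_search : forall o po, inverse_on n o po ->
  (forall i, i < d -> o i = nth 0 ds i) -> searched o po n ->
  let na := positions o po in
  forall p q, p < n -> 1 < cnt d na p ->
  (q \in na p) && earlier d p q = (q == par d na p) || (q \in na (par d na p)) && earlier d (par d na p) q.

Section Loop.
Variables (o po : nat -> nat).
Hypothesis iv : inverse_on n o po.
Hypothesis ods : forall i, i < d -> o i = nth 0 ds i.
Hypothesis so : searched o po n.
Let na := positions o po.

(** Register 12 dominates all selections whose trace has a number below [r]. A value below [n * M]
    means that no selection of k vertices has been met, hence the condition on the last clause,
    which is vacuous at the start. *)
Definition loop_state r s : Prop :=
  [/\ env s, arr s 3 = o, arr s 4 = po, forall i, i < d -> arr s 5 i = r %/ 2 ^ i %% 2 &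
     forall i, d <= i -> arr s 5 i = 0] /\
  [/\ reg s 11 = (r == 2 ^ d),
     forall (b : nat -> bool) r', r' < r -> (forall i, i < d -> r' %/ 2 ^ i %% 2 = b i) ->
       \sum_(p < n) b p = k -> n * M + value na b <= reg s 12 &
     n * M <= reg s 12 -> \sum_(p < n) odd (arr s 11 p) = k /\
       reg s 12 = n * M + value na (fun p => odd (arr s 11 p))].

Definition loop_time := 100 * (n * QK * K) + 280 * (n * QK) + 400 * n + 60 * offset nb n + 200.

Lemma wp_subset r s : r < 2 ^ d -> loop_state r s ->
  wp B (subset_code dense) s (fun t s' => t <= loop_time /\ loop_state r.+1 s').
Proof.
move=> rd [[en a3 a4 lo hi] [r11 best sol]]; have dn' := dn.
have n0 : 0 < n by apply: leq_trans kn.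
have una p : p < n -> uniq (na p) by exact: positions_uniq.
have lna p q : p < n -> q \in na p -> q < n by exact: positions_lt.
have xs1 i : arr s 5 i <= 1.
  case: (ltnP i d) => id_; last by rewrite hi.
  by rewrite lo // -ltnS ltn_mod.
have iv' : inverse_on n (arr s 3) (arr s 4) by rewrite a3 a4.
apply: wp_seq; apply: wp_conseq (wp_neighbours en iv' xs1) _.
move=> t1 s1 f1 [tm1]; rewrite a3 a4 -/na => h1.
have en1 : env s1 by apply: env_frame f1 en.
have a15 : arr s1 5 = arr s 5 by rewrite f1.2.
have xs1' i : arr s1 5 i <= 1 by rewrite a15.
have w1 p : p < n -> arr s1 6 p = fixed_weight d na (arr s1 5) p by move=> /h1[-> _ _]; rewrite a15.
apply: wp_seq; apply: wp_conseq (wp_local en1 una lna xs1' w1) _.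
move=> t2 s2 f2 [tm2 h2]; rewrite a15 in h2.
have en2 : env s2 by apply: env_frame f2 en1.
pose pa := par d na; pose cn := cnt d na.
have pa_lt c : 0 < c < n -> pa c < c by exact: par_lt.
have lo_le v x : v < n -> x < QK -> local n k d na dense (arr s 5) v x <= M + 3 * n.
  by move=> vn xQ; apply: local_le.
have p2 p : p < n -> arr s2 7 p = pa p by move=> pn; rewrite f2.2 //; case: (h1 p pn).
have c2 p : p < n -> arr s2 8 p = cn p by move=> pn; rewrite f2.2 //; case: (h1 p pn).
apply: wp_seq; apply: wp_conseq (wp_fold pa_lt lo_le en2 p2 c2 h2) _.
move=> t3 s3 f3 [tm3 h3 ch3].
have en3 : env s3 by apply: env_frame f3 en2.
have [[_ e1 _ e3 _] _] := en3.
have QKn := table_size_lt.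
have KQK : 2 * K <= QK by rewrite /QK leq_pmulr.
have kQ : k < QK by apply: leq_trans KQK; rewrite /K; lia.
have KkQ : K + k < QK by apply: leq_trans KQK; rewrite /K; lia.
pose T := table n k pa cn (local n k d na dense (arr s 5)).
pose best_r := opt n k pa cn (local n k d na dense (arr s 5)).
have optE : T 1 0 k + (T 1 0 (K + k) - T 1 0 k) = best_r by [].
have h3' x : x < QK -> arr s3 9 x = T 1 0 x by move=> xQ; have := h3 0 x n0 xQ; rewrite mul0n.
have r12_3 : reg s3 12 = reg s 12 by rewrite f3.1 // f2.1 // f1.1.
have a11_3 : arr s3 11 = arr s 11 by rewrite f3.2 // f2.2 // f1.2.
have p3 p : p < n -> arr s3 7 p = pa p by move=> pn; rewrite f3.2 // p2.
have c3 p : p < n -> arr s3 8 p = cn p by move=> pn; rewrite f3.2 // c2.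
have str := structure_of_search iv ods so.
have le_r (b : nat -> bool) : (forall i, i < d -> r %/ 2 ^ i %% 2 = b i) ->
    \sum_(p < n) b p = k -> n * M + value na b <= best_r.
  move=> rb bk; apply: opt_lower => // i id_; by rewrite lo ?rb.
apply: wp_seq; apply: wp_assign; rewrite /= e1 e3 !h3' // optE.
  have t0 : 3 * T 1 0 k < B by apply: tab_lt.
  have t1' : 3 * T 1 0 (K + k) < B by apply: tab_lt.
  by rewrite -optE; lia.
apply: wp_seq; set s4 := set_reg _ 13 _.
apply: (@wp_conseq _ _ _ (fun t s5 => [/\ t <= 150 * n + 40,
   forall (b : nat -> bool) r', r' < r.+1 -> (forall i, i < d -> r' %/ 2 ^ i %% 2 = b i) ->
       \sum_(p < n) b p = k -> n * M + value na b <= reg s5 12 &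
   n * M <= reg s5 12 -> \sum_(p < n) odd (arr s5 11 p) = k /\
       reg s5 12 = n * M + value na (fun p => odd (arr s5 11 p))])).
  apply: wp_if; rewrite /= r12_3.
    move/nat_of_bool_neq0 => lt_best; apply: wp_seq; apply: wp_assign; rewrite /=.
      have t0 : 3 * T 1 0 k < B by apply: tab_lt.
      have t1' : 3 * T 1 0 (K + k) < B by apply: tab_lt.
      by rewrite -optE; lia.
    set s5 := set_reg _ 12 _.
    have en5 : env s5 by exact: en3.
    have h5 : holds_table s5 (T 1) by exact: h3.
    apply: wp_conseq (wp_backtrack pa_lt en5 p3 c3 h5 ch3) _.
    move=> t6 s6 f6 [tm6 h6]; have r6 : reg s6 12 = best_r by rewrite f6.1.
    rewrite r6; split; first by lia.
      move=> b r'; rewrite ltnS leq_eqVlt => /predU1P[->|r'r rb bk]; first exact: le_r.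
      by apply: leq_trans (best b r' r'r rb bk) (ltnW lt_best).
    move=> ge; have [sb _ vb] := opt_solution k0 kn dn' una lna str xs1 ge.
    split; first by rewrite -[RHS]sb; apply: eq_bigr => p _; rewrite h6.
    rewrite /best_r vb; congr (_ + _); apply: eq_value => // p pn; by rewrite h6.
  move/nat_of_bool_eq0/negbT; rewrite -leqNgt => ge_best; apply: wp_skip.
  rewrite /= r12_3 a11_3; split=> //; first by lia.
  move=> b r'; rewrite ltnS leq_eqVlt => /predU1P[-> rb bk|]; last exact: best.
  by apply: leq_trans (le_r b rb bk) ge_best.
move=> t5 s5 f5 [tm5 best5 sol5].
have en4 : env s4 by exact: en3.
have en5 : env s5 by apply: env_frame f5 en4.
have a55 : arr s5 5 = arr s 5 by rewrite f5.2 //= f3.2 // f2.2 // f1.2.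
have lo5 i : i < d -> arr s5 5 i = r %/ 2 ^ i %% 2 by rewrite a55; exact: lo.
apply: wp_conseq (wp_next_subset en5 rd lo5) _.
move=> t6 s6 f6 [tm6 r11_6 lo6 hi6]; split.
  by rewrite /loop_time; move: tm1 tm2 tm3 tm5 tm6; rewrite -!mulnA; lia.
split; split=> //.
- by apply: env_frame f6 en5.
- by rewrite f6.2 // f5.2 //= f3.2 // f2.2 // f1.2.
- by rewrite f6.2 // f5.2 //= f3.2 // f2.2 // f1.2.
- by move=> i di; rewrite hi6 // a55 hi.
- by rewrite f6.1.
- by rewrite f6.1 // f6.2.
Qed.

End Loop.

Definition optimal_output s :=
  exists o po (b : nat -> bool),
    [/\ inverse_on n o po, \sum_(p < n) b p = k,
        forall b' : nat -> bool, \sum_(p < n) b' p = k ->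
          n * M + value (positions o po) b' <= n * M + value (positions o po) b &
        forall i, i < k -> arr s 0 i = nth 0 [seq o p | p <- iota 0 n & b p] i].

Lemma wp_solver s : reg s 0 = n -> reg s 1 = k -> reg s 2 = d -> reg s 11 = 0 -> reg s 12 = 0 ->
  (forall v, v <= n -> arr s 0 v = offset nb v) ->
  (forall v l, v < n -> l < size (nb v) -> arr s 1 (offset nb v + l) = nth 0 (nb v) l) ->
  (forall i, i < d -> arr s 2 i = nth 0 ds i) -> (forall i, arr s 5 i = 0) ->
  wp B (solver dense) s (fun t s' => [/\ t <= 2 ^ d * (2 * loop_time), reg s' 0 = 1 &
    optimal_output s']).
Proof.
move=> e0 e1 e2 e11 e12 o0 o1 a2 a5; have dn' := dn; have QKn := table_size_lt.
have n0 : 0 < n by apply: leq_trans kn.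
have M_B : M < B by rewrite /M; clear -B_big; nia.
apply: wp_if => /= [|_]; first by rewrite e1 (gtn_eqF k0).
apply: wp_if => /= [|_]; first by rewrite e0 e1 ltnNge kn.
apply: wp_seq; apply: wp_assign; rewrite /= e1 addn1; first lia.
apply: wp_seq; apply: wp_assign; rewrite /= -/K -/QK; first lia.
apply: wp_seq; apply: wp_assign; rewrite /= e0 -/M //.
set s1 := set_reg _ 5 _.
have en1 : env s1 by split; split.
apply: wp_seq; apply: wp_conseq (wp_identity en1) _ => t2 s2 f2 [tm2 id2].
have en2 : env s2 by apply: env_frame f2 en1.
have a2' i : i < d -> arr s2 2 i = nth 0 ds i by rewrite f2.2 //; exact: a2.
apply: wp_seq; apply: wp_conseq (wp_deletion_set en2 id2 a2') _ => t3 s3 f3 [tm3 r7 iv3 ds3].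
have en3 : env s3 by apply: env_frame f3 en2.
apply: wp_seq; apply: wp_conseq (wp_search en3 r7 iv3 ds3) _ => t4 s4 f4 [tm4 iv4 ds4 se4].
have en4 : env s4 by apply: env_frame f4 en3.
have str := structure_of_search iv4 ds4 se4.
set o := arr s4 3 in iv4 ds4 se4 str; set po := arr s4 4 in iv4 se4 str.
have r11 : reg s4 11 = 0 by rewrite f4.1 // f3.1 // f2.1.
have r12 : reg s4 12 = 0 by rewrite f4.1 // f3.1 // f2.1.
have a55 i : arr s4 5 i = 0 by rewrite f4.2 // f3.2 // f2.2 // a5.
apply: wp_seq; apply: (@wp_while _ _ _ _ 0 (2 ^ d)
  (fun r T s => T <= r * (loop_time + 4) /\ loop_state o po r s)) => //.
- split=> //; split; split=> //.
  + by move=> i _; rewrite a55 div0n.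
  + by rewrite r11 ltn_eqF ?expn_gt0.
  + by rewrite r12 leqNgt muln_gt0 n0 /M !muln_gt0 n0.
- move=> r T s' rd [_ [_ [r11' _ _]]] _; rewrite /= r11' ltn_neqAle (proj2 (andP rd)) andbT; by case: (r == 2 ^ d).
- move=> r T s' rd [Tr st] _; apply: wp_conseq (wp_subset iv4 ds4 se4 _ st) _ => //.
  by move=> t s5 _ [tm5 st5]; split=> //; rewrite mulSn /=; lia.
move=> T s5 [T5 [[en5 o5 po5 _ _] [_ best sol]]] _.
have [[e05 _ _ _ _] _] := en5.
have on p : p < n -> arr s5 3 p < n by rewrite o5 => /iv4.1 [].
(* Since k <= n, the first k positions form a selection, and the round of its trace raised register
   12 to at least [n * M]. *)
have ge : n * M <= reg s5 12.
  pose b0 p := p < k; have [r rd rb] := bits_exist b0 d.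
  apply: leq_trans (best b0 r rd rb _); first exact: leq_addr.
  rewrite sum_count -size_filter -[RHS](size_iota 0); apply: perm_size.
  apply: uniq_perm; rewrite ?filter_uniq ?iota_uniq // => p.
  rewrite mem_filter !mem_iota /b0 /=; lia.
have [sb vb] := sol ge.
apply: wp_conseq (wp_output e05 on) _ => t6 s6 _ [tm6 r0 out]; split=> //.
  have d0 : 0 < 2 ^ d by rewrite expn_gt0.
  (* A round takes [loop_time] plus 4 for the loop test; doubling [loop_time] pays for set-up,
     search and output as well. *)
  have : 160 * n + 60 * offset nb n + 160 <= 2 ^ d * (loop_time - 4).
    by apply: leq_trans (leq_pmull _ d0); rewrite /loop_time; lia.
  have h4 : 4 <= loop_time by rewrite /loop_time; lia.
  have : 2 ^ d * (loop_time - 4) + 2 ^ d * (loop_time + 4) = 2 ^ d * (2 * loop_time).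
    by rewrite -mulnDr; congr (_ * _); move: h4; clear; lia.
  move: tm2 tm3 tm4 T5 tm6; rewrite /=.
  by move: (2 ^ d * _) (2 ^ d * _) (2 ^ d * _) (offset nb n); clear; lia.
exists o, po, (fun p => odd (arr s5 11 p)); split=> //.
  move=> b' sb'; rewrite -vb; have [r rd rb] := bits_exist b' d.
  exact: best rd rb sb'.
move=> i ik; rewrite out o5 // size_map size_filter.
by rewrite -sum_count sb.
Qed.

End Verify.

(** * Positions and vertices *)

Lemma card_pairs (T : finType) (P : rel T) :
  #|[set xy : T * T | P xy.1 xy.2]| = \sum_x \sum_y P x y.
Proof.
rewrite pair_bigA -sum1_card big_mkcond /=; apply: eq_bigr => xy _.
by rewrite inE; case: (P _ _).
Qed.

Section Input.
Variables (n : nat) (adj : 'I_n -> seq 'I_n).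

Definition neighbours (v : nat) : seq nat :=
  oapp (fun i : 'I_n => map val (adj i)) [::] (insub v).

Lemma neighbours_ord (v : 'I_n) : neighbours v = map val (adj v).
Proof. by rewrite /neighbours valK. Qed.

Lemma neighbour_lists : [seq [seq val u | u <- adj v] | v <- enum 'I_n] = map neighbours (iota 0 n).
Proof.
rewrite -val_enum_ord -map_comp; apply: eq_map => v /=; by rewrite neighbours_ord.
Qed.

Lemma sumn_sizes (nb : nat -> seq nat) v : sumn (map size (map nb (iota 0 v))) = offset nb v.
Proof.
rewrite sumnE /offset !big_map -(big_mkord xpredT (fun u => size (nb u))).
by rewrite /index_iota subn0.
Qed.

Lemma nth_offsets v : v <= n ->
  nth 0 (mkseq (fun i => sumn (take i (map size (map neighbours (iota 0 n))))) n.+1) v = offset neighbours v.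
Proof.
move=> vn; rewrite nth_mkseq ?ltnS // -!map_take take_iota (minn_idPl vn).
exact: sumn_sizes.
Qed.

Lemma nth_lists (nb : nat -> seq nat) v l : v < n -> l < size (nb v) ->
  nth 0 (flatten (map nb (iota 0 n))) (offset nb v + l) = nth 0 (nb v) l.
Proof.
move=> vn ln; rewrite -(subnKC (ltnW vn)) iotaD map_cat flatten_cat nth_cat.
rewrite size_flatten /shape sumn_sizes ltnNge leq_addr /= addKn.
by rewrite add0n -[n - v]prednK ?subn_gt0 //= nth_cat ln.
Qed.

End Input.

Section Positions.
Variables (n : nat) (G : graph 'I_n) (adj : 'I_n -> seq 'I_n) (o po : nat -> nat).
Hypothesis sG : simple_graph G.
Hypothesis adjG : adjacency_lists G adj.
Let nb := neighbours adj.
Hypothesis iv : inverse_on n o po.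

Lemma mem_neighbours (u v : 'I_n) : (val u \in nb v) = adjacent G v u.
Proof.
rewrite /nb neighbours_ord mem_map; last exact: val_inj.
by rewrite (perm_mem (adjG v)) mem_enum inE.
Qed.

Lemma neighbours_uniq v : uniq (nb v).
Proof.
rewrite /nb /neighbours; case: insub => [i|] //=.
rewrite map_inj_uniq; last exact: val_inj.
by rewrite (perm_uniq (adjG i)) enum_uniq.
Qed.

Lemma neighbours_lt v u : u \in nb v -> u < n.
Proof. by rewrite /nb /neighbours; case: insub => [i|] //= /mapP[w _ ->]. Qed.

Definition position (v : 'I_n) : 'I_n := insubd v (po v).
Definition vertex (p : 'I_n) : 'I_n := insubd p (o p).

Lemma positionE (v : 'I_n) : position v = po v :> nat.
Proof. by rewrite val_insubd (iv.2 v (ltn_ord v)).1. Qed.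

Lemma vertexE (p : 'I_n) : vertex p = o p :> nat.
Proof. by rewrite val_insubd (iv.1 p (ltn_ord p)).1. Qed.

Lemma positionK : cancel position vertex.
Proof. by move=> v; apply: val_inj; rewrite /= vertexE positionE (iv.2 v (ltn_ord v)).2. Qed.

Lemma vertexK : cancel vertex position.
Proof. by move=> p; apply: val_inj; rewrite /= positionE vertexE (iv.1 p (ltn_ord p)).2. Qed.

Let na := positions nb o po.

Lemma mem_positions (u v : 'I_n) : (position u : nat) \in na (position v) = adjacent G v u.
Proof.
rewrite /na /positions (positionE v) (iv.2 v (ltn_ord v)).2 -mem_neighbours.
apply/mapP/idP => [[w wn /esym e]|un]; last by exists (val u); rewrite ?positionE.
have wlt := neighbours_lt wn; have := (iv.2 w wlt).2.
by rewrite e positionE (iv.2 u (ltn_ord u)).2 => eu; rewrite -[val u]/(nat_of_ord u) eu.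
Qed.

Lemma na_uniq p : p < n -> uniq (na p).
Proof.
move=> pn; apply: (positions_uniq _ _ iv pn) => [v _|v u _]; first exact: neighbours_uniq.
exact: neighbours_lt.
Qed.

Lemma na_lt p q : p < n -> q \in na p -> q < n.
Proof. by move=> pn; apply: (positions_lt _ iv pn) => v u _; exact: neighbours_lt. Qed.

Lemma position_inj : injective (fun v => position v : nat).
Proof. by move=> u v /val_inj /(can_inj positionK). Qed.

Lemma sum_positions (f : nat -> nat) : \sum_(p < n) f p = \sum_(v : 'I_n) f (position v).
Proof. by apply: reindex; apply: onW_bij; exists vertex; [exact: positionK | exact: vertexK]. Qed.

Lemma degree_position b (y : 'I_n) :
  degree na b (position y) =
  \sum_(x : 'I_n) [&& adjacent G x y, position x < position y & b (position x)].
Proof.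
rewrite /degree /na /positions positionE (iv.2 y (ltn_ord y)).2 /nb neighbours_ord !count_map.
rewrite (permP (adjG y)) -sum1_count big_enum_cond /= big_mkcond /=.
by apply: eq_bigr => x _; rewrite inE adjacent_sym positionE; case: (_ && _).
Qed.

Lemma sum_degree (b : nat -> bool) :
  \sum_(p < n) b p * degree na b p = induced_edges G [set v | b (position v)].
Proof.
rewrite -(pairs_below position_inj _ sG).
rewrite (card_pairs (fun x y => [&& adjacent G x y, position x < position y,
  x \in [set v | b (position v)] & y \in [set v | b (position v)]])).
rewrite exchange_big /= (sum_positions (fun p => b p * degree na b p)); apply: eq_bigr => y _.
rewrite degree_position big_distrr /=; apply: eq_bigr => x _; rewrite !inE /=.
by rewrite !andbA; case: (_ && _); case: (b _); case: (b _).
Qed.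

Lemma card_positions (b : nat -> bool) : \sum_(p < n) b p = #|[set v | b (position v)]|.
Proof.
rewrite (sum_positions (fun p => b p)) -sum1_card [RHS]big_mkcond /=.
by apply: eq_bigr => v _; rewrite inE; case: (b _).
Qed.

Lemma selection_of_set (n0 : 0 < n) (S : {set 'I_n}) : exists b : nat -> bool, [set v | b (position v)] = S.
Proof.
exists (fun p => vertex (insubd (position (Ordinal n0)) p) \in S).
by apply/setP => v; rewrite inE valKd positionK.
Qed.

Lemma perm_output (b : nat -> bool) :
  perm_eq [seq o p | p <- iota 0 n & b p] (map val (enum [set v | b (position v)])).
Proof.
apply: uniq_perm.
- rewrite map_inj_in_uniq ?filter_uniq ?iota_uniq // => p q.
  rewrite !mem_filter !mem_iota => /andP[_ pn] /andP[_ qn] e.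
  by rewrite -(iv.1 p pn).2 e (iv.1 q qn).2.
- by rewrite map_inj_uniq ?enum_uniq //; exact: val_inj.
move=> u; apply/mapP/mapP => [[p]|[v]].
  rewrite mem_filter mem_iota => /andP[bp pn] ->.
  exists (vertex (Ordinal pn)); last exact: esym (vertexE (Ordinal pn)).
  by rewrite mem_enum inE vertexK.
rewrite mem_enum inE => bv ->; exists (position v : nat); last by rewrite positionE (iv.2 v (ltn_ord v)).2.
by rewrite mem_filter bv mem_iota ltn_ord.
Qed.

Variables (D : {set 'I_n}) (ds : seq 'I_n).
Let d := size ds.
Hypothesis dsD : perm_eq ds (enum D).
Hypothesis ods : forall i, i < d -> o i = nth 0 (map val ds) i.

Lemma size_ds_le : d <= n.
Proof. by rewrite /d (perm_size dsD) -cardE -[n in _ <= n]card_ord max_card. Qed.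

Lemma mem_deletion_set v : (v \in D) = (position v < d).
Proof.
rewrite -mem_enum -(perm_mem dsD); apply/idP/idP => [vd|pd].
  have id_ : index v ds < d by rewrite index_mem.
  rewrite positionE.
  have -> : val v = o (index v ds) by rewrite ods // (nth_map v) // nth_index.
  by rewrite (iv.1 _ (leq_trans id_ size_ds_le)).2.
have := vertexE (position v); rewrite positionK ods // (nth_map v) //.
by move/val_inj => ->; apply: mem_nth.
Qed.

Hypothesis so : searched d nb o po n.
Hypothesis bG : block_graph (delete G D).
Local Notation e := (adjacent (delete G D)).

Lemma adjacent_deleteE x y : e x y = [&& adjacent G x y, d <= position x & d <= position y].
Proof. by rewrite adjacent_induced !inE !mem_deletion_set -!leqNgt. Qed.

Lemma search_positions v :
  (forall x y, position x < position v -> e x y -> position y < position v) \/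
  (exists w, position w < position v /\ e w v).
Proof.
case: (ltnP (position v) d) => [vd|dv].
  (* No edge of [delete G D] starts below position d, so the closure is vacuous. *)
  left=> x y xv; rewrite adjacent_deleteE => /and3P[_ dx _].
  by move: (leq_ltn_trans dx xv); rewrite ltnNge (ltnW vd).
have [|cl|[l' l'v vl']] := so (l := position v); first by rewrite dv /=.
  left=> x y xv; rewrite adjacent_deleteE => /and3P[axy dx dy].
  rewrite positionE; apply: (cl (position x)); first by rewrite dx.
  by rewrite positionE (iv.2 x (ltn_ord x)).2 mem_neighbours.
have ln : l' < n by case/andP: l'v => _ h; apply: ltn_trans h _.
right; exists (vertex (Ordinal ln)).
have -> : position (vertex (Ordinal ln)) = l' :> nat by rewrite vertexK.
case/andP: l'v => dl lv; split=> //; rewrite adjacent_deleteE dv vertexK /= dl !andbT.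
by rewrite -mem_neighbours vertexE /= -vertexE positionK in vl' *.
Qed.

Lemma earlier_edge (q p : 'I_n) : ((q : nat) \in na p) && earlier d p q = e (vertex q) (vertex p) && (q < p).
Proof.
rewrite -{1}[q]vertexK -{1}[p]vertexK mem_positions adjacent_deleteE !vertexK /= adjacent_sym.
case: (adjacent _ _ _) => //=; case: (ltnP q p) => [qp|]; rewrite ?andbF ?andbT //.
by case: (leqP d q) => //= dq; rewrite ltnW // (leq_ltn_trans dq).
Qed.

Lemma structure_of_block_graph p q : p < n -> 1 < cnt d na p ->
  (q \in na p) && earlier d p q = (q == par d na p) || (q \in na (par d na p)) && earlier d (par d na p) q.
Proof.
move=> pn cp; set t := par d na p.
have /andP[tp te] : (t \in na p) && earlier d p t by apply: par_earlier pn _; apply: ltnW.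
have tlp : t < p by case/andP: te.
have tn : t < n by apply: ltn_trans pn.
case: (ltnP q n) => [qn|nq]; last first.
  have -> : (q \in na p) = false by apply/negP => /(na_lt pn); rewrite ltnNge nq.
  have -> : (q \in na t) = false by apply/negP => /(na_lt tn); rewrite ltnNge nq.
  by rewrite /= orbF (gtn_eqF (leq_trans tn nq)).
(* A count above 1 yields the second earlier neighbour that [earlier_neighbours] asks for. *)
have [w [wp we wt]] : exists w, [/\ w \in na p, earlier d p w & w != t].
  have : 1 < size (filter (earlier d p) (na p)) by rewrite size_filter.
  have : uniq (filter (earlier d p) (na p)).
    by rewrite filter_uniq ?na_uniq.
  have mf x : x \in filter (earlier d p) (na p) -> x \in na p /\ earlier d p x.
    by rewrite mem_filter => /andP[].
  case: filter mf => [|x [|y s]] //= mf /andP[+ _] _.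
  rewrite inE negb_or => /andP[xy _].
  have [xn xe] := mf x (mem_head _ _).
  have [yn ye] : y \in na p /\ earlier d p y by apply: mf; rewrite !inE eqxx orbT.
  case: (eqVneq x t) => [ext|]; last by exists x.
  by exists y; split=> //; rewrite -ext eq_sym.
have wn := na_lt pn wp.
pose P := Ordinal pn; pose T := Ordinal tn; pose W := Ordinal wn; pose Q := Ordinal qn.
have /andP[eT _] : e (vertex T) (vertex P) && (T < P) by rewrite -earlier_edge tp te.
have /andP[eW wlp] : e (vertex W) (vertex P) && (W < P) by rewrite -earlier_edge wp we.
rewrite -[q]/(nat_of_ord Q) -[p]/(nat_of_ord P) earlier_edge.
have sH : simple_graph (delete G D) by exact: simple_induced.
have := @earlier_neighbours _ _ (fun v => position v : nat) sH bG position_inj search_positions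
  (vertex P) (vertex T) (vertex W) eT.
rewrite !vertexK => /(_ tlp eW wlp) main.
have neWT : vertex W != vertex T by rewrite (can_eq vertexK) -val_eqE.
have maxT x : e x (vertex P) -> position x < P -> position x <= T.
  move=> ex xp; have := earlier_edge (position x) P.
  by rewrite positionK ex xp => /andP[xn xe]; exact: leq_bigmax_seq xn xe.
by have := main neWT maxT (vertex Q); rewrite vertexK (can_eq vertexK) -val_eqE => ->; rewrite -earlier_edge.
Qed.

End Positions.

(** The handshake count: an entry of a list is an increasing or a decreasing pair. *)
Lemma sum_neighbours n (G : graph 'I_n) adj : simple_graph G -> adjacency_lists G adj ->
  offset (neighbours adj) n <= 2 * #|edges G|.
Proof.
move=> sG adjG.
have -> : #|edges G| = induced_edges G setT.
  rewrite /induced_edges /edges /induced /=; apply: eq_card => A; by rewrite inE subsetT andbT.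
rewrite -(pairs_below val_inj setT sG).
rewrite (card_pairs (fun x y => [&& adjacent G x y, val x < val y, x \in setT & y \in setT])).
rewrite mul2n -addnn {1}exchange_big -big_split /= /offset; apply: leq_sum => v _.
rewrite neighbours_ord size_map (perm_size (adjG v)) -cardE -big_split /= -sum1_card big_mkcond /=.
apply: leq_sum => u _; rewrite !inE /= [adjacent G u v]adjacent_sym !andbT.
case e: (adjacent G v u) => //=; have [_ _] := adjacent_vertices sG e.
by rewrite neq_ltn; case: ltngtP.
Qed.

(** * Correctness of the solver *)

Lemma word_size a e : exists c, forall N W, 0 < N -> c * N ^ c <= W -> (a * N ^ 3) ^ e <= W.
Proof.
(* The same constant must serve as the factor a^e and as the exponent 3e, hence the sum. *)
exists (a ^ e + 3 * e) => N W N0; apply: leq_trans; rewrite expnMn -expnM.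
by apply: leq_mul; [exact: leq_addr | apply: leq_pexp2l; rewrite // leq_addl].
Qed.

Definition store_bound n k := (20 * (n + k + 1) ^ 3).+1.

Lemma store_bound_word e : exists c, forall n k W, c * (n + k + 1) ^ c <= W ->
  (store_bound n k).+2 ^ e <= W.
Proof.
have [c word_c] := word_size 23 e; exists c => n k W cW.
have N0 : 0 < n + k + 1 by rewrite addn1.
apply: leq_trans (word_c _ _ N0 cW).
suff le_b : (store_bound n k).+2 <= 23 * (n + k + 1) ^ 3 by case: e {word_c} => // e; rewrite leq_exp2r.
have : 0 < (n + k + 1) ^ 3 by rewrite expn_gt0 N0.
by rewrite /store_bound; move: (_ ^ 3) => x; lia.
Qed.

Lemma nth_lt B s i : 0 < B -> all (fun x => x < B) s -> nth 0 s i < B.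
Proof.
move=> B0 /allP sB; case: (ltnP i (size s)) => [/(mem_nth 0)|/(nth_default 0) ->] //.
exact: sB.
Qed.

Lemma bounded_input n (adj : 'I_n -> seq 'I_n) k ds : uniq ds -> (forall v, uniq (adj v)) ->
  bounded (store_bound n k) (input adj k ds).
Proof.
move=> uds uadj; have nB m : m <= (n + k + 1) ^ 3 -> m < store_bound n k.
  by rewrite /store_bound; move: (_ ^ 3) => x; lia.
have N1 : 0 < n + k + 1 by lia.
have nn : n * n <= (n + k + 1) ^ 3.
  have nN : n <= n + k + 1 by lia.
  rewrite !expnS expn0 muln1; apply: leq_mul => //.
  exact: leq_trans nN (leq_pmulr _ N1).
have le1 m : m <= n + k + 1 -> m < store_bound n k.
  by move=> mN; apply: nB; apply: leq_trans mN _; rewrite -{1}[n + k + 1]expn1; apply: leq_pexp2l.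
have dn : size ds <= n by rewrite -[n in _ <= n]card_ord -(card_uniqP uds) max_card.
split=> [x|a i]; first apply: nth_lt => //=.
  have [h1 h2] : n <= n + k + 1 /\ k <= n + k + 1 by lia.
  by rewrite (le1 _ h1) (le1 _ h2) (le1 _ (leq_trans dn h1)).
apply: nth_lt => //; case: a => [|[|[|a]]]; [| | |by rewrite [nth _ _ _]nth_default].
- apply/(all_nthP 0) => v; rewrite size_mkseq ltnS => vn; apply: nB.
  apply: leq_trans nn; rewrite neighbour_lists [nth 0 _ _]nth_offsets //.
  apply: leq_trans (offset_mono _ vn) _.
  rewrite /offset -[n in n * _]card_ord -sum_nat_const; apply: leq_sum => u _.
  by rewrite neighbours_ord size_map -[n in _ <= n]card_ord -(card_uniqP (uadj u)) max_card.
- apply/allP => x /flattenP[s /mapP[v _ ->] /mapP[u _ ->]]; apply: le1.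
  by apply: leq_trans (ltnW (ltn_ord u)) _; lia.
- apply/allP => x /mapP[u _ ->]; apply: le1.
  by apply: leq_trans (ltnW (ltn_ord u)) _; lia.
Qed.


(** As k > 0, k + 1 is at most 2k and n is at most n k^3; the powers of k + 1 and the linear terms
    are absorbed into n k^3. *)
Lemma loop_time_le n k b m nb : 0 < k -> 0 < n -> offset nb n <= 2 * m ->
  2 * loop_time n k nb <= 100 * 100 * ((k ^ 3 + b) * n + m).
Proof.
move=> k0 n0 off.
have Kk : k.+1 <= 2 * k by lia.
have kk : k <= k * k * k by rewrite -mulnA leq_pmulr // muln_gt0 k0.
have kkk : k * k <= k * k * k by rewrite leq_pmulr.
have QK_le : 2 * k.+1 * k.+1 <= 8 * (k * k).
  by apply: leq_trans (leq_mul (leq_mul (leqnn 2) Kk) Kk) _; lia.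
have QKK_le : 2 * k.+1 * k.+1 * k.+1 <= 16 * (k * k * k).
  by apply: leq_trans (leq_mul QK_le Kk) _; lia.
have n_QKK := leq_mul (leqnn n) QKK_le.
have n_QK := leq_mul (leqnn n) (leq_trans QK_le (leq_mul (leqnn 8) kkk)).
have n_k : n <= n * (k * k * k) by rewrite leq_pmulr // (leq_trans k0).
have -> : k ^ 3 = k * k * k by rewrite !expnSr expn0 mul1n.
rewrite /loop_time mulnDl; rewrite mulnA in n_QKK.
by move: n_QKK n_QK n_k off n0; clear; lia.
Qed.

Lemma solver_correct dense : exists c, forall (n : nat) (G : graph 'I_n) (k : nat) (D : {set 'I_n}),
  simple_graph G -> vertices G = [set: 'I_n] -> block_deletion_set G D -> #|D| = bd G ->
  solves_within (solver dense) c G k D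
    (if dense then densest_subgraph G k else sparsest_subgraph G k)
    (100 * 100 * maxn 1 (2 ^ bd G * ((k ^ 3 + bd G) * n + #|edges G|))).
Proof.
have [c word_c] := store_bound_word 60.
exists c => n G k D sG VG /andP[_ bG] cD adj ds W adjG dsD cW.
have uds : uniq ds by rewrite (perm_uniq dsD) enum_uniq.
have uadj v : uniq (adj v) by rewrite (perm_uniq (adjG v)) enum_uniq.
have sd : size ds = bd G by rewrite (perm_size dsD) -cardE.
have B10 : 10 <= store_bound n k.
  have : 0 < (n + k + 1) ^ 3 by rewrite expn_gt0 addn1.
  by rewrite /store_bound; move: (_ ^ 3) => x; lia.
set s := input adj k ds; have bs : bounded (store_bound n k) s by exact: bounded_input.
suff [t [s' [r [tle ans]]]] : wp (store_bound n k) (solver dense) s (fun t s' =>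
    t <= 100 * 100 * maxn 1 (2 ^ bd G * ((k ^ 3 + bd G) * n + #|edges G|)) /\
    answers (if dense then densest_subgraph G k else sparsest_subgraph G k) k s').
  by exists t, s'; split=> //; case: (run_exec B10 (word_c _ _ _ cW) (solver_small dense) bs r).
(* For k = 0 and for n < k the answer takes constant time, but the other argument of [maxn] may
   vanish; [maxn 1] pays for it. *)
have t_max t : t <= 100 -> t <= 100 * 100 * maxn 1 (2 ^ bd G * ((k ^ 3 + bd G) * n + #|edges G|)).
  by move=> t1; apply: leq_trans (leq_mul (leqnn _) (leq_maxl _ _)); lia.
have [k0|k0] := posnP k.
  apply: wp_if => /= [_|]; last by rewrite k0.
  apply: wp_assign => /=; first lia.
  split; first exact: t_max.
  rewrite /answers k0 leq0n; split=> //; exists set0; last by rewrite enum_set0.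
  by case: dense; split; rewrite ?sub0set ?cards0 // => S _ /cards0_eq->.
have [kn|nk] := leqP k n; last first.
  apply: wp_if => /= [|_]; first by rewrite (gtn_eqF k0).
  apply: wp_if => /= [_|]; last by rewrite nk.
  apply: wp_assign => /=; first lia.
  by split; [exact: t_max | rewrite /answers leqNgt nk].
have n0 : 0 < n by apply: leq_trans kn.
have B_big : 20 * n.+1 * n.+1 * n.+1 < store_bound n k.
  rewrite /store_bound ltnS -!mulnA leq_mul2l /= !expnS expn0 muln1.
  have h : n.+1 <= n + k + 1 by lia.
  by rewrite !leq_mul.
have nb_uniq v : v < n -> uniq (neighbours adj v) by move=> _; exact: neighbours_uniq adjG v.
have nb_lt v u : v < n -> u \in neighbours adj v -> u < n by move=> _; exact: neighbours_lt.
have uds' : uniq (map val ds) by rewrite map_inj_uniq //; exact: val_inj.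
have ds_lt u : u \in map val ds -> u < n by case/mapP=> w _ ->; exact: ltn_ord.
have str o po (iv : inverse_on n o po) ods so :=
  @structure_of_block_graph n G adj o po sG adjG iv D ds dsD ods so bG.
have e0 v : v <= n -> arr s 0 v = offset (neighbours adj) v.
  by move=> vn; rewrite -(nth_offsets adj vn) -neighbour_lists.
have e1 v l : v < n -> l < size (neighbours adj v) ->
    arr s 1 (offset (neighbours adj) v + l) = nth 0 (neighbours adj v) l.
  by move=> vn ln; rewrite -(nth_lists vn ln) -neighbour_lists.
have e5 i : arr s 5 i = 0 by rewrite /s /= !nth_nil.
have e2 i : i < size ds -> arr s 2 i = nth 0 (map val ds) i by [].
have sol := wp_solver dense k0 kn nb_uniq nb_lt uds' ds_lt (size_map val ds) B_big str
  (erefl : reg s 0 = n) (erefl : reg s 1 = k) (erefl : reg s 2 = size ds)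
  (erefl : reg s 11 = 0) (erefl : reg s 12 = 0) e0 e1 e2 e5.
apply: wp_conseq sol _.
move=> t s' _ [tle r0 [o [po [b [iv bk best out]]]]]; split.
  apply: leq_trans tle _; rewrite sd.
  apply: leq_trans _ (leq_mul (leqnn _) (leq_maxr _ _)).
  rewrite [100 * 100 * _]mulnCA leq_mul2l; apply/orP; right.
  exact: (loop_time_le _ k0 n0 (sum_neighbours sG adjG)).
rewrite /answers kn; split=> //.
have S_k := card_positions iv b; rewrite bk in S_k.
set S := [set v | _] in S_k; exists S; last first.
  apply: perm_trans (perm_output iv b).
  have size_k : size [seq o p | p <- iota 0 n & b p] = k.
    by rewrite size_map size_filter -sum_count bk.
  rewrite (_ : mkseq _ _ = [seq o p | p <- iota 0 n & b p]) //.
  apply: (@eq_from_nth _ 0); rewrite size_mkseq ?size_k // => i ik.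
  by rewrite nth_mkseq // out.
have una p : p < n -> uniq (positions (neighbours adj) o po p) by exact: na_uniq adjG iv p.
have lna p q : p < n -> q \in positions (neighbours adj) o po p -> q < n by exact: na_lt iv p q.
have valE (b' : nat -> bool) : \sum_(p < n) b' p = k ->
    value n dense (positions (neighbours adj) o po) b' = binop_val (if dense then OpAdd else OpSub) (k * n)
      (induced_edges G [set v | b' (position po v)]) /\
    induced_edges G [set v | b' (position po v)] <= k * n.
  move=> bk'; rewrite -(sum_degree sG adjG iv b'); split; first exact: sum_signed.
  exact: sum_degree_le.
have main (S' : {set 'I_n}) : #|S'| = k -> if dense then induced_edges G S' <= induced_edges G S
    else induced_edges G S <= induced_edges G S'.
  move=> S'k; have [b' eS'] := selection_of_set iv n0 S'.
  have bk' : \sum_(p < n) b' p = k by rewrite (card_positions iv) eS'.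
  have [v1 l1] := valE b' bk'; have [v2 l2] := valE b bk.
  have := best b' bk'; rewrite v1 v2 -/S eS' leq_add2l; rewrite -/S in l2; rewrite eS' in l1.
  by case: (dense) => /=; [rewrite leq_add2l | lia].
have SV : S \subset vertices G by rewrite VG subsetT.
by case: (dense) main => main; split=> // S' _ /main.
Qed.

Theorem theorem2 :
  (exists (p : prog) (c C : nat),
    forall (n : nat) (G : graph 'I_n) (k : nat) (D : {set 'I_n}),
      simple_graph G -> vertices G = [set: 'I_n] ->
      block_deletion_set G D -> #|D| = bd G ->
      solves_within p c G k D (densest_subgraph G k)
        (C * maxn 1 (2 ^ bd G * ((k ^ 3 + bd G) * n + #|edges G|))))
  /\
  (exists (p : prog) (c C : nat),
    forall (n : nat) (G : graph 'I_n) (k : nat) (D : {set 'I_n}),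
      simple_graph G -> vertices G = [set: 'I_n] ->
      block_deletion_set G D -> #|D| = bd G ->
      solves_within p c G k D (sparsest_subgraph G k)
        (C * maxn 1 (2 ^ bd G * ((k ^ 3 + bd G) * n + #|edges G|)))).
Proof.
by split; [have [c] := solver_correct true; exists (solver true), c, (100 * 100)
          | have [c] := solver_correct false; exists (solver false), c, (100 * 100)].
Qed.
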